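(* The top cycle is the only pairwise social choice correspondence that satisfies (Fishburn-)strategyproofness, set non-imposition, and homogeneity.
   Context: Let $\mathbb{N}=\{1,2,\dots\}$ be the set of potential voters and $A$ a finite set of alternatives. An electorate is a finite non-empty $N\subseteq\mathbb{N}$; each voter $i\in N$ has a strict total order $\succ_i$ on $A$. A preference profile is $R\in\mathcal{R}(A)^N$ for some electorate $N$; $\mathcal{R}^*(A)$ is the set of all profiles over all electorates. The majority margin is $g_R(x,y)=|\{i: x\succ_i y\}|-|\{i: y\succ_i x\}|$; $x\succsim_R y$ iff $g_R(x,y)\ge0$, with strict part $\succ_R$. For sets, $X\succ Y$ means $x\succ y$ for all $x\in X,y\in Y$. A non-empty $X\subseteq A$ is dominant in $R$ if $X\succ_R A\setminus X$. The top cycle $\mathrm{TC}(R)$ is the inclusion-smallest dominant set (dominant sets are totally ordered by inclusion), equivalently the set of $x$ such that for every $y$ there is a path $x=x_1\succsim_R x_2\succsim_R\dots\succsim_R x_k=y$. An SCC is a map $f:\mathcal{R}^*(A)\to 2^A\setminus\{\emptyset\}$. $f$ is pairwise if $f(R)=f(R')$ whenever $g_R=g_{R'}$. $f$ satisfies set non-imposition if for every non-empty $X\subseteq A$ some profile $R$ has $f(R)=X$. $f$ is homogeneous if $f(kR)=f(R)$ for every profile $R$ and $k\ge1$, where $kR$ consists of $k$ copies of $R$. Fishburn's extension: for $X\neq Y$, $X\succ_i^F Y$ iff $X\setminus Y\succ_i Y$ and $X\succ_i Y\setminus X$. $f$ is strategyproof if there is no electorate $N$, voter $i\in N$ and profiles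 $R,R'\in\mathcal{R}(A)^N$ with $\succ_j=\succ'_j$ for all $j\ne i$ and $f(R')\succ_i^F f(R)$. *)

(* Defs.v *)
From HB Require Import structures.
From mathcomp Require Import all_boot all_order all_algebra.
From mathcomp Require Import finmap.
Set Implicit Arguments. Unset Strict Implicit. Unset Printing Implicit Defensive.
Import Order.TTheory GRing.Theory Num.Theory.
Local Open Scope fset_scope.
Local Open Scope fmap_scope.

Section SCC.
Variable A : finType.

(* Strict total (linear) orders on A, encoded as boolean relations "r (x,y) = x > y". *)
Definition is_lorder (r : {ffun A * A -> bool}) : bool :=
  [&& [forall x, ~~ r (x, x)],
      [forall x, forall y, forall z, r (x, y) ==> r (y, z) ==> r (x, z)] &
      [forall x, forall y, (x != y) ==> r (x, y) || r (y, x)]].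

Definition lorder := {r : {ffun A * A -> bool} | is_lorder r}.

Definition lpref (o : lorder) (x y : A) : bool := (val o) (x, y).

Definition is_profile (m : {fmap nat -> lorder}) : bool :=
  (domf m != fset0) && (0%N \notin domf m).

Definition profile := {m : {fmap nat -> lorder} | is_profile m}.

Definition electorate (R : profile) : {fset nat} := domf (val R).

(* preference of voter i in R (the empty relation if i is not a voter) *)
Definition vpref (R : profile) (i : nat) (x y : A) : bool :=
  match (val R).[? i] with Some o => lpref o x y | None => false end.

Definition margin (R : profile) (x y : A) : int :=
  (#|` [fset i in electorate R | vpref R i x y]|%:Z
   - #|` [fset i in electorate R | vpref R i y x]|%:Z)%R.

Definition wmaj (R : profile) : rel A := fun x y => (0 <= margin R x y)%R.

Definition TC (R : profile) : {set A} :=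
  [set x | [forall y, connect (wmaj R) x y]].

Definition SCC := profile -> {set A}.

Definition is_scc (f : SCC) : Prop := forall R, f R != set0.

Definition pairwise_scc (f : SCC) : Prop :=
  forall R R', (forall x y, margin R x y = margin R' x y) -> f R = f R'.

Definition set_non_imposition (f : SCC) : Prop :=
  forall X : {set A}, X != set0 -> exists R, f R = X.

Definition is_copies (k : nat) (R R' : profile) : Prop :=
  exists phi : electorate R' -> electorate R * 'I_k,
    bijective phi /\
    forall j : electorate R', vpref R' (val j) =2 vpref R (val (phi j).1).

Definition homogeneous (f : SCC) : Prop :=
  forall (k : nat) (R R' : profile), (1 <= k)%N -> is_copies k R R' -> f R' = f R.

Definition fishburn (o : lorder) (X Y : {set A}) : bool :=
  [&& X != Y,
      [forall x in X :\: Y, forall y in Y, lpref o x y] &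
      [forall x in X, forall y in Y :\: X, lpref o x y]].

Definition strategyproof (f : SCC) : Prop :=
  forall (R R' : profile) (i : nat),
    electorate R = electorate R' -> i \in electorate R ->
    (forall j, j \in electorate R -> j != i -> (val R).[? j] = (val R').[? j]) ->
    forall o : lorder, (val R).[? i] = Some o ->
    ~~ fishburn o (f R') (f R).

End SCC.

(* Main.v *)
Require Import Defs.
From HB Require Import structures.
From mathcomp Require Import all_boot all_order all_algebra.
From mathcomp Require Import finmap.
From mathcomp Require Import zify.

(* A pairwise and homogeneous rule is a scale-invariant function [F] of the
   skew-symmetric matrix of margins. A voter and her mirror image can always be added
   to the electorate, so strategyproofness restricts every elementary change of the
   matrix: weakening an alternative outside the outcome against the whole outcome,
   or changing margins outside the outcome, has no effect, and weakening a single
   [x] against a single [y] changes the outcome in four ways only.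

   By induction on [n] one shows simultaneously that [F h] is the top cycle of [h]
   whenever the top cycle has at most [n] elements (forward), and whenever [F h] has
   at most [n] elements (backward). Forward: if [X] is the top cycle of [h], start
   from a matrix with outcome [X] given by set non-imposition and walk to [h] through
   matrices with top cycle [X]. Backward: if [F h = Y] is not dominant, weaken the
   outside until some [e] is just tied with a member of [Y] and [Z = e |: Y] is the
   top cycle. If [Y] is a singleton, this contradicts the existence of a matrix with
   outcome [Z]; otherwise [F h = Z :\ e] is led to an outcome that a proper subset
   of it dominates, which the forward part forbids. *)

Set Implicit Arguments.
Unset Strict Implicit.
Unset Printing Implicit Defensive.

Import Order.TTheory GRing.Theory Num.Theory.

Local Open Scope ring_scope.

(** * Skew-symmetric matrices and their top cycles *)

Section Matrices.

Variable A : finType.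

Local Notation mat := {ffun A * A -> int}.

Implicit Types (h g : mat) (X Y Z B G U V : {set A}) (m : int) (r : A -> nat).

Definition skewsym h := forall x y, h (x, y) = - h (y, x).

Definition dominates h X Y := forall x y, x \in X -> y \in Y -> 0 < h (x, y).

Definition dominant h X := forall x y, x \in X -> y \notin X -> 0 < h (x, y).

Definition top_cycle h : {set A} :=
  [set x | [forall y, connect (fun u v => 0 <= h (u, v)) x y]].

(** On the scale of half margins, the effect of a voter who lowers [x] from just above [y] to just
    below it. *)
Definition swap h x y : mat :=
  [ffun p => h p - (p == (x, y))%:Z + (p == (y, x))%:Z].

Definition between h h' g :=
  forall p, (h p <= g p <= h' p) \/ (h' p <= g p <= h p).

(** Small ranks are on top; ties are broken by the enumeration of [A], so that every [r] yields a
    linear order. *)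
Definition above r x y : bool :=
  (r x < r y)%N || ((r x == r y) && (enum_rank x < enum_rank y)%N).

Lemma swapE h x y u v : swap h x y (u, v) =
  h (u, v) - ((u == x) && (v == y))%:Z + ((u == y) && (v == x))%:Z.
Proof. by rewrite ffunE !xpair_eqE. Qed.

Lemma skewsym_swap h x y : skewsym h -> skewsym (swap h x y).
Proof.
move=> sh u v; rewrite !swapE (sh u v).
rewrite [(v == x) && _]andbC [(v == y) && _]andbC; lia.
Qed.

Lemma skewsym_diag h x : skewsym h -> h (x, x) = 0.
Proof. by move=> sh; have := sh x x; lia. Qed.

(** Induction on the L1 distance to [h']: a swap at an entry above its target brings this entry and
    its mirror one unit closer, and never leaves the box between [h] and [h']. *)
Lemma walk (P : mat -> Prop) h h' : skewsym h -> skewsym h' ->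
    (forall g x y, skewsym g -> between h h' g -> between h h' (swap g x y) ->
       x != y -> h' (x, y) < h (x, y) -> P g -> P (swap g x y)) ->
  P h -> P h'.
Proof.
move=> sh sh' step.
suff main n g : (\sum_p `|h' p - g p| <= n)%N -> skewsym g -> between h h' g ->
    P g -> P h'.
  by apply: (main _ h (leqnn _)) => // p; case: (leP (h p) (h' p)); lia.
elim: n g => [|n IHn] g.
  move=> le0 sg _ Pg; suff -> : h' = g by [].
  apply/ffunP=> p; move: le0; rewrite leqn0 sum_nat_eq0 => /forallP /(_ p) /=.
  lia.
move=> len sg bg Pg.
case: (pickP (fun p => g p > h' p)) => [[x y] lt_p|ge_p]; last first.
  suff -> : h' = g by [].
  apply/ffunP=> -[x y]; have := ge_p (x, y); have := ge_p (y, x).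
  by rewrite /= (sg y x) (sh' y x); lia.
have neq : x != y.
  by apply: contraTneq lt_p => ->; rewrite !skewsym_diag // ltxx.
have neq' : y != x by rewrite eq_sym.
have bg' : between h h' (swap g x y).
  move=> [u v]; rewrite swapE; have := bg (u, v).
  case: (eqVneq u x) => [->|nux]; case: (eqVneq v y) => [->|nvy] /=.
  - rewrite (negPf neq) /=; move: lt_p; lia.
  - by rewrite (negPf neq) /=; lia.
  - by rewrite [y == x]eq_sym (negPf neq) andbF; lia.
  - case: (eqVneq u y) => [->|nuy] /=; last by lia.
    case: (eqVneq v x) => [->|nvx] /=; last by lia.
    by move: lt_p; rewrite (sg x y) (sh' x y); lia.
apply: (IHn (swap g x y)) => //; last first.
- apply: step => //; have := bg (x, y); move: lt_p; lia.
- exact: skewsym_swap.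
rewrite -ltnS; apply: leq_trans len.
rewrite (bigD1 (x, y)) //= [X in (_ < X)%N](bigD1 (x, y)) //= -addSn.
apply: leq_add.
  by rewrite swapE !eqxx (negPf neq) /=; move: lt_p; lia.
apply: leq_sum => -[u v]; rewrite xpair_eqE negb_and => nxy.
rewrite swapE; case: (eqVneq u x) nxy => [->|nux] /= nxy.
  by rewrite (negPf nxy) (negPf neq) /=; lia.
case: (eqVneq u y) => [->|nuy] /=; last by lia.
case: (eqVneq v x) => [->|nvx] /=; last by lia.
by move: lt_p; rewrite (sg x y) (sh' x y); lia.
Qed.

(** * The top cycle as the least dominant set *)

Lemma top_cycle_sub h X :
  skewsym h -> X != set0 -> dominant h X -> top_cycle h \subset X.
Proof.
move=> sh /set0Pn[z zX] dX; apply/subsetP=> x; rewrite inE => /forallP/(_ z).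
case/connectP=> p; elim: p x => [|y p IHp] x /=; first by move=> _ <-.
case/andP=> xy pth lst; have yX := IHp y pth lst.
apply: contraLR xy => xX; rewrite -ltNge (sh x y).
by have := dX y x yX xX; lia.
Qed.

Lemma top_cycle_dominant h : skewsym h -> dominant h (top_cycle h).
Proof.
move=> sh x y; rewrite !inE => /forallP xall; apply: contraNT => xy.
apply/forallP=> z; apply: connect_trans (xall z); apply: connect1.
by rewrite (sh y x); move: xy; lia.
Qed.

(** An alternative with the most reachable alternatives reaches all: one it misses would beat it and
    reach strictly more. *)
Lemma top_cycle_n0 h (x0 : A) : skewsym h -> top_cycle h != set0.
Proof.
move=> sh; set e := fun u v => 0 <= h (u, v).
pose reach x := [set y | connect e x y].
case: (@arg_maxnP _ x0 predT (fun x => #|reach x|) isT) => x _ xmax.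
apply/set0Pn; exists x; rewrite inE; apply/forallP=> y; apply: contraT => nxy.
have eyx : e y x.
  rewrite /e (sh y x); have : ~~ e x y by apply: contraNN nxy; exact: connect1.
  by rewrite /e; lia.
have : (#|reach x| < #|reach y|)%N.
  apply: proper_card; apply/properP; split.
    apply/subsetP=> z; rewrite !inE; apply: connect_trans; exact: connect1.
  by exists y; rewrite !inE.
by have := xmax y isT; rewrite /geq /= ltnNge => ->.
Qed.

Lemma top_cycleP h X : skewsym h -> X != set0 -> dominant h X ->
    (forall B, B != set0 -> B \subset X -> dominant h B -> X \subset B) ->
  top_cycle h = X.
Proof.
move=> sh X0 dX minX; have sub := top_cycle_sub sh X0 dX.
have [x0 _] := set0Pn _ X0.
apply/eqP; rewrite eqEsubset sub minX //; first exact: (top_cycle_n0 x0 sh).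
exact: top_cycle_dominant.
Qed.

(* The matrices met on the way from [h] to the matrix in which the entries
   indexed by [U * V] have been lifted to at least [m]. *)
Definition raised h U V m g :=
  [/\ skewsym g,
      forall x y, ~~ ((x \in U) && (y \in V)) -> ~~ ((x \in V) && (y \in U)) ->
        g (x, y) = h (x, y) &
      forall x y, x \in U -> y \in V ->
        h (x, y) <= g (x, y) /\ (g (x, y) <= h (x, y) \/ g (x, y) <= m)].

Lemma raise_walk (P : mat -> Prop) h U V m : skewsym h -> [disjoint U & V] ->
    (forall g x y, raised h U V m g -> raised h U V m (swap g x y) ->
       x \in V -> y \in U -> x != y -> h (y, x) < m ->
       h (y, x) < swap g x y (y, x) -> P g -> P (swap g x y)) ->
  P h ->
  exists g, [/\ P g, raised h U V m g &
              forall x y, x \in U -> y \in V -> m <= g (x, y)].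
Proof.
move=> sh dUV step Ph.
pose up p : bool := (p.1 \in U) && (p.2 \in V).
have upN x y : up (x, y) -> ~~ up (y, x).
  rewrite /up /= => /andP[xU yV]; rewrite negb_and; apply/orP; left.
  by apply: contraL yV => yU; rewrite (disjointFr dUV).
(* The target is the maximum of [h] and [m] on [U * V], with its mirror on [V * U]. *)
pose h' : mat := [ffun p =>
  if up p then (if m <= h p then h p else m)
  else if up (p.2, p.1) then (if - m >= h p then h p else - m) else h p].
have sh' : skewsym h'.
  move=> x y; rewrite !ffunE /= (sh x y).
  case: (boolP (up (x, y))) => [/upN/negPf ->|_]; last by case: (up (y, x));
    [case: ifP; case: ifP; lia|].
  by case: ifP; case: ifP; lia.
have bw g : skewsym g -> between h h' g -> raised h U V m g.
  move=> sg bg; split=> // x y.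
    move=> nu nu'; have := bg (x, y); rewrite ffunE /= /up /= (negPf nu).
    by rewrite [(y \in U) && _]andbC (negPf nu'); lia.
  move=> xU yV; have := bg (x, y); rewrite ffunE /= /up /= xU yV /=.
  by case: ifP; lia.
exists h'; split.
- apply: (walk sh sh' _ Ph) => g x y sg bg bg' nxy lt_xy Pg.
  have sg' := skewsym_swap x y sg.
  have [bx by'] : x \in V /\ y \in U.
    apply/andP; apply: contraTT lt_xy => nxyV; rewrite ffunE /=.
    have -> : up (y, x) = false by rewrite /up /= andbC; apply: negbTE.
    by case: ifP => _; [case: ifP|]; lia.
  have upyx : up (y, x) by rewrite /up /= by'.
  have lt_m : h (y, x) < m.
    move: lt_xy; rewrite ffunE /= upyx (negPf (upN _ _ upyx)) (sh x y).
    by case: ifP; lia.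
  apply: (step g) => //; try exact: bw.
  have := bg (y, x); rewrite swapE !eqxx [y == x]eq_sym (negPf nxy) /=.
  rewrite ffunE upyx; move: lt_m; clear; case: ifP; lia.
- by apply: bw => // p; case: (leP (h p) (h' p)); lia.
by move=> x y xU yV; rewrite ffunE /up /= xU yV /=; case: ifP; lia.
Qed.

(** A canonical matrix with top cycle [X]: all ties, except that [X] beats its complement by one. *)
Definition block X : mat :=
  [ffun p => ((p.1 \in X) && (p.2 \notin X))%:Z - ((p.1 \notin X) && (p.2 \in X))%:Z].

Lemma skewsym_block X : skewsym (block X).
Proof. by move=> x y; rewrite !ffunE /=; do 2 case: (_ \in X). Qed.

End Matrices.

(** * Strategyproof functions of the matrix *)

Section Rule.

Variable A : finType.

Local Notation mat := {ffun A * A -> int}.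

Implicit Types (h g : mat) (X Y Z B G : {set A}) (r : A -> nat).
Implicit Types (k n : nat).

Variable F : mat -> {set A}.

Hypothesis F_homogeneous :
  forall h k, skewsym h -> (0 < k)%N -> F (h *+ k) = F h.

(** A voter with true ranking [r] reports [r']; the last two premises are Fishburn's comparison of
    [F h'] with [F h]. *)
Hypothesis F_strategyproof : forall r r' h h', skewsym h ->
    (forall x y, h' (x, y) = h (x, y) + (above r' x y)%:Z - (above r x y)%:Z) ->
    F h' != F h ->
    (forall u v, u \in F h' :\: F h -> v \in F h -> above r u v) ->
    (forall u v, u \in F h' -> v \in F h :\: F h' -> above r u v) ->
  False.

Hypothesis F_nonempty : forall h, F h != set0.

Hypothesis F_surjective : forall X, X != set0 -> exists2 h, skewsym h & F h = X.

(* A voter with [F h'] minus [F h] on top, then [F h] and [F h'] in common, then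
   the rest of [F h], would gain from the swap; the four cases are those in which
   [x] cannot stand immediately above [y] in such an order. *)
Lemma swap_cases h x y X Y : skewsym h -> x != y ->
    F h = X -> F (swap h x y) = Y -> Y != X ->
  [\/ [/\ x \in X, x \in Y, y \notin X & y \in Y],
      [/\ x \in X, x \notin Y, y \in X & y \in Y],
      [/\ x \in X, x \notin Y, y \notin X & y \in Y] |
      [/\ x \notin X, x \in Y, y \in X, y \notin Y & X :&: Y != set0]].
Proof.
move=> sh nxy hX hY neqYX.
pose k z : nat := if z \in Y then (if z \in X then 1 else 0)%N
                  else (if z \in X then 2 else 3)%N.
(* The classes of [k] are spaced by 4, so that [x] and [y] fit, adjacent, right after class [c];
   [r'] exchanges them. *)
pose r (c : nat) z := (if z == x then 4 * c + 1 else
                       if z == y then 4 * c + 2 else 4 * k z)%N.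
pose r' (c : nat) z := (if z == y then 4 * c + 1 else
                        if z == x then 4 * c + 2 else 4 * k z)%N.
have diff c u v : swap h x y (u, v) =
    h (u, v) + (above (r' c) u v)%:Z - (above (r c) u v)%:Z.
  have nyx : (y == x) = false by rewrite eq_sym (negPf nxy).
  rewrite swapE /above /r /r'.
  case: (eqVneq u x) => [->|nux]; case: (eqVneq v x) => [->|nvx];
    rewrite ?eqxx ?nyx ?(negPf nxy) ?andbF /=;
    try case: (eqVneq u y) => [->|nuy]; try case: (eqVneq v y) => [->|nvy];
    rewrite ?eqxx ?nyx ?(negPf nxy) ?andbF /=; lia.
have no c : (forall u v, u \in Y :\: X -> v \in X -> (r c u < r c v)%N) ->
    (forall u v, u \in Y -> v \in X :\: Y -> (r c u < r c v)%N) -> False.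
  move=> c1 c2; apply: (F_strategyproof sh (diff c)); rewrite hX hY //.
    by move=> u v uP vX; rewrite /above c1.
  by move=> u v uP vX; rewrite /above c2.
have fin c : (forall u v, u \in Y -> v \in X -> (u \notin X) || (v \notin Y) ->
    (r c u < r c v)%N) -> False.
  move=> c1; apply: (no c) => u v; rewrite inE.
    by case/andP=> uX uY vX; apply: c1; rewrite ?uX.
  by move=> uY /andP[vY vX]; apply: c1; rewrite ?vY ?orbT.
have ksmall u v : u \in Y -> v \in X -> (u \notin X) || (v \notin Y) ->
    (k u < k v)%N.
  by rewrite /k => -> ->; case: ifP; case: ifP.
have kY u : u \in Y -> (k u <= 1)%N by rewrite /k => ->; case: ifP.
have kP u : u \in Y -> u \notin X -> k u = 0%N by rewrite /k => -> /negPf ->.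
have kE z : k z = if z \in Y then (if z \in X then 1 else 0)%N
                  else (if z \in X then 2 else 3)%N by [].
have kx := kE x; have ky := kE y.
have fit c : (x \in Y -> c <= k x)%N -> (y \in Y -> c <= k y)%N ->
    (x \in X -> forall u, u \in Y -> k u < k x -> k u <= c)%N ->
    (y \in X -> forall u, u \in Y -> k u < k y -> k u <= c)%N ->
    ~~ [&& y \in Y, x \in X & k y < k x]%N -> False.
  move=> c1 c2 c3 c4 c5; apply: (fin c) => u v uY vX nuv.
  have := ksmall u v uY vX nuv.
  rewrite /r; clearbody k; clear -c1 c2 c3 c4 c5 uY vX.
  case: (eqVneq u x) => [eux|nux].
    rewrite eux in uY *; have {}c1 := c1 uY.
    case: (eqVneq v x) => [->|nvx]; first by rewrite ltnn.
    by case: (eqVneq v y) => _; clear -c1; lia.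
  case: (eqVneq u y) => [euy|nuy].
    rewrite euy in uY *; have {}c2 := c2 uY.
    case: (eqVneq v x) => [evx|nvx].
      by rewrite evx in vX * => kuv; rewrite uY vX kuv in c5.
    by case: (eqVneq v y) => [->|nvy]; [rewrite ltnn|clear -c2; lia].
  case: (eqVneq v x) => [evx|nvx].
    by rewrite evx in vX * => kuv; have := c3 vX u uY kuv; clear; lia.
  case: (eqVneq v y) => [evy|nvy]; last by clear; lia.
  by rewrite evy in vX * => kuv; have := c4 vX u uY kuv; clear; lia.
move: kx ky fit.
case xX: (x \in X); case xY: (x \in Y); case yX: (y \in X); case yY: (y \in Y);
  try by move=> *; constructor.
all: move=> kx ky fit.
(* The lower of the two classes suits every remaining case but one, where [x] enters and [y] leaves;
   there class 0 suits if [X] and [Y] are disjoint. *)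
all: try by exfalso; apply: (fit (minn (k x) (k y)));
  rewrite kx ky //= => _ u /kY; clear; lia.
case: (boolP (X :&: Y == set0)) => [/eqP/setP XY0|]; last by constructor.
exfalso; apply: (fit 0%N); rewrite ?kx ?ky //= => _ u uY; have := XY0 u.
by rewrite !inE uY andbT => /negbT /(kP _ uY) ->.
Qed.

Lemma swap_outside h x y X : skewsym h -> x != y -> x \notin X -> y \notin X ->
  F h = X -> F (swap h x y) = X.
Proof.
move=> sh nxy xX yX hX; apply/eqP; apply: contraT => neq.
by case: (swap_cases sh nxy hX erefl neq) => -[];
  rewrite ?(negPf xX) ?(negPf yX).
Qed.

Definition weaken h Y o : mat :=
  [ffun p => h p + ((p.1 \in Y) && (p.2 == o))%:Z
                 - ((p.1 == o) && (p.2 \in Y))%:Z].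

Lemma skewsym_weaken h Y o : skewsym h -> skewsym (weaken h Y o).
Proof.
move=> sh u v; rewrite !ffunE /= (sh u v).
rewrite [(v \in Y) && _]andbC [(v == o) && _]andbC; lia.
Qed.

(* A voter placing [o] just above the block [F h], ordered inside as in
   [swap_cases], would gain from any change of outcome. *)
Lemma F_weaken h o : skewsym h -> o \notin F h -> F (weaken h (F h) o) = F h.
Proof.
move=> sh oY; set Y := F h; set W := F _; apply/eqP; apply: contraT => neq.
pose k z : nat := if z \in Y then (if z \in W then 2 else 3)%N
                  else (if z \in W then 0 else 5)%N.
have kY z : z \in Y -> (1 < k z < 4)%N by rewrite /k => ->; case: ifP.
have kNY z : z \notin Y -> (k z < 1)%N || (4 < k z)%N.
  by rewrite /k => /negPf ->; case: ifP.
(* Rank 1 puts [o] just above [Y], which occupies ranks 2 and 3, and rank 4 just below. Rank 1 is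
   high enough even if [o] belongs to [W]. *)
pose r i z := (if z == o then i else k z)%N.
exfalso; apply: (F_strategyproof (r := r 1) (r' := r 4) (h := h)
                   (h' := weaken h Y o)) => //.
- move=> u v; rewrite ffunE /= /above /r.
  case: (eqVneq u o) => [->|nuo]; case: (eqVneq v o) => [->|nvo].
  + by rewrite (negPf oY) /=; clear; lia.
  + rewrite (negPf oY) /=; case: (boolP (v \in Y)) => vY.
      by have := kY _ vY; clearbody k; clear; lia.
    by have := kNY _ vY; clearbody k; clear; lia.
  + rewrite andbT /=; case: (boolP (u \in Y)) => uY.
      by have := kY _ uY; clearbody k; clear; lia.
    by have := kNY _ uY; clearbody k; clear; lia.
  + by rewrite andbF /=; clearbody k; clear; lia.
- move=> u v; rewrite inE => /andP[uY uW] vY.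
  rewrite /above /r /k uW (negPf uY) vY.
  case: (eqVneq v o) => [vo|_]; first by rewrite vo (negPf oY) in vY.
  by case: ifP; case: ifP.
- move=> u v uW; rewrite inE => /andP[vW vY].
  rewrite /above /r /k uW vY (negPf vW).
  case: (eqVneq v o) => [vo|_]; first by rewrite vo (negPf oY) in vY.
  by case: ifP => // _; case: ifP.
Qed.

(** [F_weaken] spends [kappa] unit by unit; once all margins involving [Y] agree, swaps outside [Y]
    adjust the rest. *)
Lemma F_free h h' Y (kappa : A -> nat) : skewsym h -> skewsym h' -> F h = Y ->
    (forall x y, x \in Y -> y \in Y -> h' (x, y) = h (x, y)) ->
    (forall x o, x \in Y -> o \notin Y -> h' (x, o) = h (x, o) + (kappa o)%:Z) ->
  F h' = Y.
Proof.
move=> sh sh' hY inY; have [n] := ubnP (\sum_(o | o \notin Y) kappa o)%N.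
elim: n h kappa sh hY inY => // n IHn h kappa sh hY inY lt_n outY.
case: (pickP (fun o => (o \notin Y) && (0 < kappa o)%N)) => [o|k0].
  case/andP=> oY k_gt0.
  apply: (IHn (weaken h Y o) (fun z => kappa z - (z == o))%N).
  - exact: skewsym_weaken.
  - by rewrite -hY F_weaken // hY.
  - move=> x y xY yY; rewrite inY // ffunE /= xY yY andbT /=.
    have -> : (y == o) = false by apply: contraNF oY => /eqP <-.
    have -> : (x == o) = false by apply: contraNF oY => /eqP <-.
    by rewrite /=; lia.
  - rewrite (bigD1 o) //= eqxx; move: lt_n; rewrite (bigD1 o) //=.
    rewrite [X in (_ + X < _)%N -> _](eq_bigr (fun z => kappa z - (z == o))%N).
      by move: k_gt0; clear; lia.
    by move=> z /andP[_ /negPf ->]; rewrite subn0.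
  - move=> x z xY zY; rewrite outY // ffunE /= xY (negPf zY) andbF /=.
    by case: (eqVneq z o) => [->|_] /=; move: k_gt0; clear; lia.
have same x y : (x \in Y) || (y \in Y) -> h' (x, y) = h (x, y).
  have half u v : u \in Y -> h' (u, v) = h (u, v).
    move=> uY; have [vY|vY] := boolP (v \in Y); first exact: inY.
    by rewrite outY //; have := k0 v; rewrite vY /=; clear; lia.
  by case/orP=> [/half-> // | yY]; rewrite sh' half // -sh.
apply: (walk (P := fun g => F g = Y) sh sh' _ hY) => g x y sg _ _ nxy lt_xy gY.
apply: swap_outside => //; apply: contraTN lt_xy => yY.
  by rewrite same ?yY // ltxx.
by rewrite same ?yY ?orbT // ltxx.
Qed.

Definition push h Y (kappa : A -> nat) : mat :=
  [ffun p => h p + (if (p.1 \in Y) && (p.2 \notin Y) then (kappa p.2)%:Z else 0)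
                 - (if (p.1 \notin Y) && (p.2 \in Y) then (kappa p.1)%:Z else 0)].

Lemma skewsym_push h Y kappa : skewsym h -> skewsym (push h Y kappa).
Proof.
move=> sh x y; rewrite !ffunE /= (sh x y) andbC [(x \notin Y) && _]andbC.
by case: ifP; case: ifP; lia.
Qed.

Lemma push_in h Y kappa x y :
  x \in Y -> y \in Y -> push h Y kappa (x, y) = h (x, y).
Proof. by move=> xY yY; rewrite ffunE /= xY yY addr0 subr0. Qed.

Lemma push_out h Y kappa x y : x \in Y -> y \notin Y ->
  push h Y kappa (x, y) = h (x, y) + (kappa y)%:Z.
Proof. by move=> xY yY; rewrite ffunE /= xY yY subr0. Qed.

Lemma F_push h Y kappa : skewsym h -> F h = Y -> F (push h Y kappa) = Y.
Proof.
move=> sh hY; apply: (F_free (kappa := kappa) sh (skewsym_push _ _ sh) hY).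
  exact: push_in.
exact: push_out.
Qed.

(** A push by this amount outweighs every entry of [h]. *)
Definition bound h : nat := (\sum_p `|h p|).+1.

Lemma bound_lt h p : `|h p| < (bound h)%:Z.
Proof. by rewrite /bound (bigD1 p) //=; lia. Qed.

(** * The two inductive statements and the forward half of the induction *)

Definition forward n :=
  forall h, skewsym h -> (#|top_cycle h| <= n)%N -> F h = top_cycle h.

Definition backward n :=
  forall h, skewsym h -> (#|F h| <= n)%N -> top_cycle h = F h.

(* Pushing down the complement of [F h] does not affect the outcome but makes
   every dominating subset of [F h] dominant. *)
Lemma forward_connected n h B : forward n -> skewsym h -> (#|F h| <= n)%N ->
    B != set0 -> B \subset F h -> dominates h B (F h :\: B) ->
  F h \subset B.
Proof.
move=> fwd sh cY B0 sBY domB; set h' := push h (F h) (fun=> bound h).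
have sh' : skewsym h' by apply: skewsym_push.
have sub : top_cycle h' \subset B.
  apply: top_cycle_sub => // x y xB yB; have xY := subsetP sBY _ xB.
  have [yY|yY] := boolP (y \in F h).
    by rewrite push_in //; apply: domB; rewrite // inE yB.
  by rewrite push_out //; have := bound_lt h (x, y); lia.
rewrite -{1}(F_push (fun=> bound h) sh erefl) fwd //.
exact: leq_trans (subset_leq_card sub) (leq_trans (subset_leq_card sBY) cY).
Qed.

(** Pushing down only the part of [Z] outside the outcome makes [F h :&: Z] dominant; it has at most
    [n] elements, so [forward] applies. *)
Lemma forward_dominant n h Z : forward n -> skewsym h -> dominant h Z ->
    (#|Z| <= n.+1)%N -> F h :&: Z != set0 -> ~~ (Z \subset F h) ->
  F h \proper Z.
Proof.
move=> fwd sh dZ cZ FZ0 nsub; set Y := F h; rewrite properE nsub andbT.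
set h' := push h Y (fun o => if o \in Z then bound h else 0%N).
have sh' : skewsym h' by apply: skewsym_push.
have sub : top_cycle h' \subset Y :&: Z.
  apply: top_cycle_sub => // x y; rewrite !inE negb_and => /andP[xY xZ] yYZ.
  have [yY|yY] := boolP (y \in Y).
    by rewrite push_in //; apply: dZ => //; move: yYZ; rewrite yY.
  rewrite push_out //; case: ifP => yZ; first by have := bound_lt h (x, y); lia.
  by rewrite addr0; apply: dZ; rewrite ?yZ.
have hY : F h' = Y by apply: F_push.
suff tY : F h' = top_cycle h'.
  by rewrite -hY tY; apply: subset_trans sub (subsetIr _ _).
apply: fwd => //; rewrite -ltnS; apply: leq_trans cZ.
apply: leq_ltn_trans (subset_leq_card sub) _; apply: proper_card.
by rewrite properE subsetIr subsetI negb_and nsub.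
Qed.

(* As long as [X] is the top cycle, the outcome contains [X] or avoids it, and
   then [swap_cases] leaves no way of quitting [X]. *)
Lemma F_plateau n h h' X : forward n -> backward n -> #|X| = n.+1 ->
    skewsym h -> skewsym h' ->
    (forall g, skewsym g -> between h h' g -> top_cycle g = X) ->
    (forall x o, x \in X -> o \notin X -> h (x, o) <= h' (x, o)) ->
  F h = X -> F h' = X.
Proof.
move=> fwd bwd cX sh sh' tX up.
apply: (walk (P := fun g => F g = X)) => // g x y sg _ bg' nxy lt_xy gX.
have sg' := skewsym_swap x y sg; have tg' := tX _ sg' bg'.
set Y := F (swap g x y); apply/eqP; apply: contraT => neq.
(* An outcome meeting [X] without containing it is properly inside [X], hence equal to the top cycle
   [X] by [backward]. *)
have dich u : u \in X -> u \in Y -> X \subset Y.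
  move=> uX uY; apply: contraT => nsub.
  have prop : Y \proper X.
    apply: (forward_dominant fwd sg'); rewrite ?cX //.
      by rewrite -tg'; apply: top_cycle_dominant.
    by apply/set0Pn; exists u; rewrite inE uY.
  have := bwd _ sg'; rewrite tg' -/Y -ltnS -cX proper_card // => /(_ isT) eXY.
  by rewrite eXY subxx in nsub.
have notup : x \in X -> y \notin X -> False.
  by move=> xX yX; have := up _ _ xX yX; move: lt_xy; lia.
case: (swap_cases sg nxy gX erefl neq) => -[].
- by move=> xX _ yX _; case: (notup xX yX).
- by move=> xX xY yX yY; have /subsetP/(_ _ xX) := dich y yX yY; rewrite (negPf xY).
- by move=> xX _ yX _; case: (notup xX yX).
- move=> _ _ yX yY /set0Pn[u]; rewrite inE => /andP[uX uY].
  by have /subsetP/(_ _ yX) := dich u uX uY; rewrite (negPf yY).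
Qed.

(* Both [h0] with [F h0 = X], once pushed down, and [h] are joined to a multiple of
   [block X] by paths along which [X] remains the top cycle; homogeneity allows
   the multiples of [block X] to be identified. *)
Lemma forward_step n : forward n -> backward n -> forward n.+1.
Proof.
move=> fwd bwd h sh; rewrite leq_eqVlt => /orP[/eqP cX|]; last exact: fwd.
set X := top_cycle h; have X0 : X != set0 by rewrite -card_gt0 cX.
have dX : dominant h X by apply: top_cycle_dominant.
have [h0 sh0 h0X] := F_surjective X0.
set h1 := push h0 X (fun=> bound h0).
have sh1 : skewsym h1 by apply: skewsym_push.
have h1X : F h1 = X by apply: F_push.
have dX1 : dominant h1 X.
  by move=> x y xX yX; rewrite push_out //; have := bound_lt h0 (x, y); lia.
(* A smaller top cycle would be the outcome, by [forward]. *)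
have tX1 : top_cycle h1 = X.
  have sub := top_cycle_sub sh1 X0 dX1.
  apply/eqP; rewrite eqEsubset sub; apply: contraT => nsub.
  have tF : F h1 = top_cycle h1.
    by apply: fwd; rewrite // -ltnS -cX proper_card // properE sub.
  by rewrite -tF h1X subxx in nsub.
have sE k : skewsym (block X *+ k).
  by move=> x y; rewrite !ffunMnE (skewsym_block X x y) mulNrn.
have Ein k x y : x \in X -> y \in X -> (block X *+ k) (x, y) = 0.
  by move=> xX yX; rewrite ffunMnE ffunE /= xX yX mul0rn.
have Eout k x y : x \in X -> y \notin X -> (block X *+ k) (x, y) = k%:Z.
  by move=> xX yX; rewrite ffunMnE ffunE /= xX yX; lia.
have tXg h2 g k : (0 < k)%N -> skewsym h2 -> top_cycle h2 = X -> skewsym g ->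
    (between h2 (block X *+ k) g) -> top_cycle g = X.
  move=> k0 sh2 t2 sg bg.
  have d2 : dominant h2 X by rewrite -t2; apply: top_cycle_dominant.
  have dg : dominant g X.
    move=> x y xX yX; have := bg (x, y); rewrite Eout //.
    by have := d2 _ _ xX yX; move: k0; lia.
  apply: top_cycleP => // B B0 sBX dB; rewrite -t2; apply: top_cycle_sub => //.
  move=> x y xB yB; have xX := subsetP sBX _ xB.
  have [yX|yX] := boolP (y \in X); last exact: d2.
  by have := bg (x, y); have := dB _ _ xB yB; rewrite Ein //; lia.
(* This multiple is large enough for the margins of [X] over its complement only to rise. *)
have kE : F (block X *+ bound h1) = X.
  apply: (F_plateau fwd bwd cX sh1) => //.
    by move=> g; apply: tXg.
  by move=> x o xX oX; rewrite Eout //; have := bound_lt h1 (x, o); lia.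
have E1 : F (block X *+ 1) = X.
  by move: kE; rewrite !(F_homogeneous (sE 1%N)).
(* They rise again from [block X], where they are 1, to [h], where they are positive integers. *)
apply: (F_plateau fwd bwd cX _ sh) E1 => //.
  move=> g sg bg; apply: (tXg h g 1%N) => // p.
  by case: (bg p); [right|left].
by move=> x o xX oX; rewrite Eout //; have := dX _ _ xX oX; lia.
Qed.

(** For non-empty [X]: [b] is in the top cycle of [h] restricted to [X]. *)
Definition reaches h X b := forall B, B != set0 -> B \subset X ->
  dominates h B (X :\: B) -> b \in B.

Lemma reaches_mono h g X b :
    (forall x y, x \in X -> y \in X -> 0 < g (x, y) -> 0 < h (x, y)) ->
  reaches h X b -> reaches g X b.
Proof.
move=> pos rh B B0 sBX dB; apply: rh => // x y xB yXB; apply: pos; last exact: dB.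
  exact: (subsetP sBX).
by move: yXB; rewrite inE => /andP[].
Qed.

(* While [Z] is the top cycle, an outcome properly contained in [Z] misses exactly
   one alternative, and by [swap_removes] a swap can only pass this role on to one
   of the two alternatives involved. The contradiction is reached by isolating the
   lowest alternative of the outcome, which must be connected, while [Z] stays
   the top cycle. *)
Section Exclusion.

Variables (n : nat) (Z : {set A}) (e : A).

Hypothesis fwd : forward n.+2.
Hypothesis bwd : backward n.+1.
Hypothesis cardZ : #|Z| = n.+3.
Hypothesis eZ : e \in Z.

(** The outcome lies properly inside [Z] by [forward_dominant], and [backward] excludes sizes up to
    [n.+1]. *)
Lemma outcome_removes g u v : skewsym g -> top_cycle g = Z ->
  u \in Z -> u \in F g -> v \in Z -> v \notin F g -> F g = Z :\ v.
Proof.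
move=> sg tZ uZ uF vZ vF.
have prop : F g \proper Z.
  apply: (forward_dominant fwd sg); rewrite ?cardZ //.
  - by rewrite -tZ; apply: top_cycle_dominant.
  - by apply/set0Pn; exists u; rewrite inE uF.
  - by apply: contra vF => /subsetP/(_ _ vZ).
have cF : (n.+1 < #|F g|)%N.
  rewrite ltnNge; apply/negP => /(bwd sg); rewrite tZ => eZF.
  by rewrite -eZF vZ in vF.
apply/eqP; rewrite eqEcard subsetD1 vF (proper_sub prop).
by have := cardsD1 v Z; rewrite vZ cardZ; move: cF; clear; lia.
Qed.

(** As [y] is in the old outcome, two of the four [swap_cases] vanish; [outcome_removes] identifies
    the new outcome in the others. *)
Lemma swap_removes g c x y : skewsym g -> top_cycle (swap g x y) = Z ->
    c \in Z -> x \in Z -> y \in Z -> x != y -> y != c -> F g = Z :\ c ->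
  [\/ F (swap g x y) = Z :\ c,
      x != c /\ F (swap g x y) = Z :\ x |
      x = c /\ F (swap g x y) = Z :\ y].
Proof.
move=> sg tZ cZ xZ yZ nxy nyc gF; have sg' := skewsym_swap x y sg.
case: (eqVneq (F (swap g x y)) (Z :\ c)) => [|neq]; first by constructor 1.
have yR : y \in Z :\ c by rewrite !inE nyc.
case: (swap_cases sg nxy gF erefl neq) => -[].
- by rewrite yR.
- move=> xX xF _ yF; constructor 2; split; first by move: xX; rewrite !inE => /andP[].
  exact: (outcome_removes sg' tZ yZ yF xZ xF).
- by rewrite yR.
- rewrite !inE xZ andbT negbK => /eqP xc xF _ yF /set0Pn[u].
  rewrite !inE => /andP[/andP[_ uZ] uF]; constructor 3; split=> //.
  exact: (outcome_removes sg' tZ uZ uF yZ yF).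
Qed.

Lemma third u w : exists v, [/\ v \in Z, v != u & v != w].
Proof.
have : (0 < #|Z :\ u :\ w|)%N.
  have := cardsD1 u Z; have := cardsD1 w (Z :\ u); rewrite cardZ.
  by case: (u \in Z); case: (w \in _) => /=; clear; lia.
by case/card_gt0P=> v; rewrite !inE => /and3P[? ? ?]; exists v.
Qed.

(** Otherwise the rest of the outcome dominates [u], against [forward_connected]. *)
Lemma bottom_removed g w u : skewsym g -> w \in Z -> u \in Z -> u != w ->
    (forall v, v \in Z -> v != u -> v != w -> 0 < g (v, u)) ->
  F g <> Z :\ w.
Proof.
move=> sg wZ uZ nuw bot gF.
have cF : (#|F g| <= n.+2)%N.
  by have := cardsD1 w Z; rewrite wZ cardZ gF; clear; lia.
have [v [vZ nvu nvw]] := third u w.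
have : F g \subset F g :\ u.
  apply: (forward_connected fwd sg cF); last 1 first.
  - move=> x y; rewrite gF !inE => /and3P[nxu nxw xZ].
    case/andP; rewrite negb_and negbK => + /andP[nyw yZ].
    by rewrite nyw yZ orbF => /eqP ->; apply: bot.
  - by apply/set0Pn; exists v; rewrite gF !inE nvu nvw.
  - exact: subsetDl.
by move/subsetP/(_ u); rewrite gF !inE eqxx nuw uZ => /(_ isT).
Qed.

(** The invariant of most walks below: [e] is weakly lowest in [Z], and its tie with [a] closes the
    cycle. *)
Definition shape g a :=
  [/\ skewsym g, dominant g Z, forall y, y \in Z :\ e -> 0 <= g (y, e),
      g (a, e) = 0 & reaches g (Z :\ e) a].

(** A dominant part of [Z] without [e] would contain [a], which does not beat [e]; one with [e] is
    all of [Z], as [e] beats nothing there. *)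
Lemma shape_top g a : shape g a -> top_cycle g = Z.
Proof.
case=> sg dZ ge gae ra; apply: top_cycleP => //.
  by apply/set0Pn; exists e.
move=> B B0 sBZ dB; have [eB|eB] := boolP (e \in B); last first.
  have sBY : B \subset Z :\ e by rewrite subsetD1 sBZ.
  have : a \in B.
    apply: ra => // x y xB; rewrite inE => /andP[yB _]; exact: dB.
  by move=> aB; have := dB _ _ aB eB; rewrite gae.
apply/subsetP=> y yZ; case: (eqVneq y e) => [-> //|nye]; apply: contraT => yB.
have := dB _ _ eB yB; rewrite (sg e y).
by have := ge y; rewrite !inE nye yZ => /(_ isT); clear; lia.
Qed.

Definition ties g := [set y in Z :\ e | g (y, e) == 0].

Lemma ties_lt g h y : (forall z, z \in Z :\ e -> 0 <= g (z, e) <= h (z, e)) ->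
    y \in Z :\ e -> g (y, e) = 0 -> 0 < h (y, e) ->
  (#|ties h| < #|ties g|)%N.
Proof.
move=> le yZ gy hy; apply: proper_card; apply/properP; split.
  apply/subsetP=> z; rewrite inE => /andP[zZ /eqP hz]; rewrite inE zZ /=.
  by have := le _ zZ; rewrite hz; clear; lia.
by exists y; rewrite inE yZ ?gy //=; move: hy; clear; lia.
Qed.

Lemma ties_le g h : (forall z, z \in Z :\ e -> 0 <= g (z, e) <= h (z, e)) ->
  (#|ties h| <= #|ties g|)%N.
Proof.
move=> le; apply: subset_leq_card; apply/subsetP=> z.
rewrite inE => /andP[zZ /eqP hz]; rewrite inE zZ /=.
by have := le _ zZ; rewrite hz; clear; lia.
Qed.

Definition excluded g := [/\ F g = Z :\ e, skewsym g, dominant g Z,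
  forall y, y \in Z :\ e -> 0 <= g (y, e) &
  exists2 a, a \in Z :\ e & g (a, e) = 0].

Variable t : nat.

(** Breaking a tie with [e] in an excluded matrix with at most [t] ties must therefore change the
    outcome. *)
Hypothesis minimal : forall g, excluded g -> (t <= #|ties g|)%N.

(** A swap of [e] with a tied [y] other than [b] could only turn the outcome into [Z :\ e], giving
    an excluded matrix with fewer than [t] ties. *)
Lemma raise_over_e g w b : shape g w -> w \in Z :\ e -> F g = Z :\ b ->
    b \in Z :\ e -> (b = w \/ 0 < g (b, e)) -> (#|ties g| <= t)%N ->
  exists h, [/\ F h = Z :\ b, shape h w,
    raised g (Z :\ e :\ w) [set e] 1 h &
    forall y, y \in Z :\ e :\ w -> 0 < h (y, e)].
Proof.
move=> shg wY gF bY bw le_t; have [sg dZ ge gwe rw] := shg.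
have [nbe bZ] : b != e /\ b \in Z by move: bY; rewrite !inE => /andP.
have [nwe wZ] : w != e /\ w \in Z by move: wY; rewrite !inE => /andP.
have dis : [disjoint Z :\ e :\ w & [set e]].
  by rewrite disjoint_sym disjoints1 !inE eqxx andbF.
have keep h : raised g (Z :\ e :\ w) [set e] 1 h -> shape h w.
  case=> sh same up; split=> //.
  - move=> x y xZ yZ; rewrite same ?(negPf yZ) //; first exact: dZ.
      by rewrite !inE negb_and orbC; case: (eqVneq y e) yZ => // ->; rewrite eZ.
    by rewrite !inE (negPf yZ) !andbF.
  - move=> y yY; case: (eqVneq y w) => [->|nyw].
      by rewrite same ?gwe // !inE ?eqxx // (negPf nwe).
    have [] := up y e; rewrite ?inE ?nyw //; last by have := ge y yY; clear; lia.
    by move: yY; rewrite !inE.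
  - by rewrite same // !inE ?eqxx // (negPf nwe).
  - apply: reaches_mono rw => x y; rewrite !inE => /andP[nxe _] /andP[nye _].
    by rewrite same // !inE ?(negPf nxe) ?(negPf nye) ?andbF.
have [h [hF hr hup]] : exists h, [/\ F h = Z :\ b,
    raised g (Z :\ e :\ w) [set e] 1 h &
    forall y z, y \in Z :\ e :\ w -> z \in [set e] -> 1 <= h (y, z)].
  apply: (raise_walk (P := fun h => F h = Z :\ b)) => // h x y hr hr'.
  rewrite inE => /eqP xe /[dup] yU; rewrite !inE => /and3P[nyw nye yZ] ney lt1 ltye hF.
  subst x.
  have shh' := keep _ hr'; have [sh _ _] := hr.
  have nyb : y != b.
    case: bw => [-> //|gb]; apply: contraTneq gb => <-.
    by move: lt1; clear; lia.
  case: (swap_removes sh (shape_top shh') bZ eZ yZ ney nyb hF) => //; last first.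
    by case=> eb; rewrite eb eqxx in nbe.
  case=> _ h'F; exfalso; have [sh' dZ' ge' h'we _] := shh'.
  have : (t <= #|ties (swap h e y)|)%N by apply: minimal; split=> //; exists w.
  have yY : y \in Z :\ e by rewrite !inE nye.
  have := @ties_lt g (swap h e y) y; rewrite ltnNge => lt le; move: lt.
  rewrite (leq_trans le_t le) => lt.
  suff: ~~ true by []; apply: lt => //.
  - move=> z zY; rewrite ge //=; have [_ same up] := hr'.
    case: (eqVneq z w) => [->|nzw].
      by rewrite same // !inE ?eqxx // (negPf nwe).
    by have [] := up z e; rewrite ?inE ?nzw //; move: zY; rewrite !inE.
  - by have := ge y yY; move: lt1; clear; lia.
  - by have := ge y yY; move: ltye; clear; lia.
exists h; split=> //; first exact: keep.
by move=> y yU; have := hup y e yU (set11 _); clear; lia.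
Qed.

(** Once all of [Z :\ e :\ b] beats [e], the outcome has [e] at its bottom. *)
Lemma no_tied_removal g b : shape g b -> b \in Z :\ e -> F g = Z :\ b ->
  (#|ties g| <= t)%N -> False.
Proof.
move=> shg bY gF le_t.
have [h [hF [sh _ _ _ _] _ up]] := raise_over_e shg bY gF bY (or_introl erefl) le_t.
have [nbe bZ] : b != e /\ b \in Z by move: bY; rewrite !inE => /andP.
apply: (bottom_removed sh bZ eZ _ _ hF); first by rewrite eq_sym.
by move=> v vZ nve nvb; apply: up; rewrite !inE nvb nve.
Qed.

(** A dominant part of [Z] must contain [b], hence [a], hence [e], hence everything that beats
    [e]. *)
Lemma connected_cycle_top h a b : skewsym h -> dominant h Z -> a \in Z ->
    b \in Z :\ e :\ a -> (forall y, y \in Z :\ e :\ a -> 0 < h (y, e)) ->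
    0 <= h (a, b) -> h (a, e) <= 0 -> reaches h (Z :\ e :\ a) b ->
  top_cycle h = Z.
Proof.
move=> sh dZ aZ bG Ge ab ae rb; apply: top_cycleP => //.
  by apply/set0Pn; exists e.
move=> B B0 sBZ dB.
have bB : b \in B.
  have [BG0|BG0] := eqVneq (B :&: (Z :\ e :\ a)) set0; last first.
    have : b \in B :&: (Z :\ e :\ a).
      apply: rb => //; first exact: subsetIr.
      move=> x y; rewrite in_setI => /andP[xB _].
      rewrite in_setD in_setI negb_and => /andP[/orP[yB|/negPf ->]] // _.
      exact: dB.
    by rewrite inE => /andP[].
  apply: contraT => bB; have [z zB] := set0Pn _ B0.
  have zZ := subsetP sBZ _ zB.
  have eB : e \notin B.
    apply/negP => eB; have := dB _ _ eB bB; rewrite (sh e b).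
    by have := Ge _ bG; clear; lia.
  have nze : z != e by apply: contraNneq eB => <-.
  have : z \notin Z :\ e :\ a.
    by apply/negP => zG; have /setP/(_ z) := BG0; rewrite in_setI zB zG inE.
  rewrite !inE nze zZ !andbT negbK => /eqP za; rewrite za in zB.
  by have := dB _ _ zB eB; move: ae; clear; lia.
have aB : a \in B.
  apply: contraT => aB; have := dB _ _ bB aB; rewrite (sh b a).
  by move: ab; clear; lia.
have eB : e \in B.
  by apply: contraT => eB; have := dB _ _ aB eB; move: ae; clear; lia.
apply/subsetP=> y yZ; case: (eqVneq y e) => [-> //|nye].
case: (eqVneq y a) => [-> //|nya]; apply: contraT => yB.
have := dB _ _ eB yB; rewrite (sh e y).
by have := Ge y; rewrite !inE nya nye yZ => /(_ isT); clear; lia.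
Qed.

(* [e] has no outlet but [a]; once [a] has no outlet but [b], the outcome [Z :\ b]
   is disconnected whereas [a], [b], the rest and [e] still form a cycle. *)
Lemma no_untied_removal g a b : shape g a -> a \in Z :\ e ->
    b \in Z :\ e :\ a -> reaches g (Z :\ e :\ a) b -> F g = Z :\ b ->
    0 < g (b, e) -> (#|ties g| <= t)%N ->
  False.
Proof.
move=> shg aY bG rb gF gbe le_t.
have [nae aZ] : a != e /\ a \in Z by move: aY; rewrite !inE => /andP.
have [nba nbe bZ] : [/\ b != a, b != e & b \in Z].
  by move: bG; rewrite !inE => /and3P.
have bY : b \in Z :\ e by rewrite !inE nbe.
have [h [hF shh [_ same3 _] Ge]] := raise_over_e shg aY gF bY (or_intror gbe) le_t.
have {}rb : reaches h (Z :\ e :\ a) b.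
  apply: reaches_mono rb => x y; rewrite !inE => /and3P[_ nxe _] /and3P[_ nye _].
  by rewrite same3 // !inE ?(negPf nxe) ?(negPf nye) ?andbF.
move: h hF shh Ge rb {same3 shg gF gbe le_t g} => g gF shg Ge rb.
(* With [a] removed, [e] would be at the bottom of the outcome. *)
have noa h : skewsym h -> (forall y, y \in Z :\ e :\ a -> 0 < h (y, e)) ->
    F h <> Z :\ a.
  move=> sh he; apply: (bottom_removed sh aZ eZ); first by rewrite eq_sym.
  by move=> v vZ nve nva; apply: he; rewrite !inE nva nve.
have [sg dZ ge gae ra] := shg.
(* First [a] is raised to at least a tie with [b]; the only other possible outcome is [Z :\ a]. *)
have [h [hF shh he rhb hab]] : exists h, [/\ F h = Z :\ b, shape h a,
    forall y, y \in Z :\ e :\ a -> 0 < h (y, e),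
    reaches h (Z :\ e :\ a) b & 0 <= h (a, b)].
  have dis : [disjoint [set a] & [set b]].
    by rewrite disjoints1 inE eq_sym.
  have keep h : raised g [set a] [set b] 0 h -> [/\ shape h a,
      forall y, y \in Z :\ e :\ a -> 0 < h (y, e) &
      reaches h (Z :\ e :\ a) b].
    case=> sh same up; split.
    - split=> //.
      + move=> x y xZ yZ; rewrite same ?dZ // !inE.
          by case: (eqVneq y b) yZ => [->|]; rewrite ?bZ ?andbF.
        by case: (eqVneq y a) yZ => [->|]; rewrite ?aZ ?andbF.
      + by move=> y yY; rewrite same ?ge // !inE ?[e == a]eq_sym ?[e == b]eq_sym
          ?(negPf nbe) ?(negPf nae) andbF.
      + by rewrite same // !inE ?[e == a]eq_sym ?[e == b]eq_sym
          ?(negPf nbe) ?(negPf nae) andbF.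
      + apply: reaches_mono ra => x y _ _.
        case: (boolP ((x == a) && (y == b))) => [/andP[/eqP -> /eqP ->]|n1].
          have [] := up a b (set11 _) (set11 _); clear; lia.
        case: (boolP ((x == b) && (y == a))) => [/andP[/eqP -> /eqP ->]|n2].
          rewrite (sh b a) (sg b a).
          have [] := up a b (set11 _) (set11 _); clear; lia.
        by rewrite same // !inE.
    - by move=> y yG; rewrite same ?Ge // !inE ?[e == a]eq_sym ?[e == b]eq_sym
          ?(negPf nbe) ?(negPf nae) andbF.
    - apply: reaches_mono rb => x y; rewrite !inE => /and3P[nxa _ _] /and3P[nya _ _].
      by rewrite same // !inE ?(negPf nxa) ?(negPf nya) ?andbF.
  have [h [hF /keep[sh he hb] hab]] : exists h, [/\ F h = Z :\ b,
      raised g [set a] [set b] 0 h &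
      forall x y, x \in [set a] -> y \in [set b] -> 0 <= h (x, y)].
    apply: (raise_walk (P := fun h => F h = Z :\ b)) => // h x y hr /keep[sh' he' _].
    rewrite !inE => /eqP xb /eqP ya nxy _ _ hF; subst x y.
    have [sh _ _] := hr.
    case: (swap_removes sh (shape_top sh') bZ bZ aZ nxy _ hF) => //.
    - by rewrite eq_sym.
    - by rewrite eqxx; case.
    - by case=> _ /noa; case=> //; case: sh'.
  by exists h; split=> //; apply: hab; rewrite inE.
move: h hF shh he rhb hab {sg dZ ge gae ra shg Ge rb gF g} => g gF shg Ge rb gab.
have [sg dZ ge gae ra] := shg.
have dis : [disjoint Z :\ a :\ b & [set a]].
  by rewrite disjoint_sym disjoints1 !inE eqxx andbF.
have keep h : raised g (Z :\ a :\ b) [set a] 1 h ->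
    top_cycle h = Z /\ forall y, y \in Z :\ e :\ a -> 0 < h (y, e).
  case=> sh same up.
  have he y : y \in Z :\ e :\ a -> 0 < h (y, e).
    move=> yG; rewrite same ?Ge //; rewrite !inE ?[e == a]eq_sym ?(negPf nae) ?andbF //.
    by move: yG; rewrite !inE => /and3P[/negPf ->].
  split=> //; apply: (@connected_cycle_top h a b) => //.
  - move=> x y xZ yZ; rewrite same ?dZ // !inE ?(negPf yZ) ?andbF //.
    by case: (eqVneq y a) yZ => [->|]; rewrite ?aZ ?andbF.
  - by rewrite same // !inE ?eqxx ?andbF ?(negPf nba).
  - rewrite (sh a e); have [] := up e a; rewrite ?inE ?[e == _]eq_sym ?nae ?eZ ?nbe //.
    by rewrite (sg e a) gae; clear; lia.
  - apply: reaches_mono rb => x y; rewrite !inE => /and3P[nxa _ _] /and3P[nya _ _].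
    by rewrite same // !inE ?(negPf nxa) ?(negPf nya) ?andbF.
(* Then all of [Z] but [b], including [e], is raised above [a], which ends at the bottom of the
   outcome. *)
have [h [hF [sh _ _] ha]] : exists h, [/\ F h = Z :\ b,
    raised g (Z :\ a :\ b) [set a] 1 h &
    forall y x, y \in Z :\ a :\ b -> x \in [set a] -> 1 <= h (y, x)].
  apply: (raise_walk (P := fun h => F h = Z :\ b)) => // h x y [sh _ _] hr'.
  rewrite inE => /eqP xa yU nxy _ _ hF; subst x.
  have [tZ he] := keep _ hr'; have [sh' _ _] := hr'.
  move: yU; rewrite !inE => /and3P[nyb nya yZ].
  case: (swap_removes sh tZ bZ aZ yZ nxy nyb hF) => //.
  - by case=> _ /noa; case.
  - by case=> ab; rewrite ab eqxx in nba.
apply: (bottom_removed sh bZ aZ _ _ hF); first by rewrite eq_sym.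
move=> v vZ nva nvb; have := ha v a _ (set11 a); rewrite !inE nva nvb vZ => /(_ isT).
by clear; lia.
Qed.

(* [G1] is the top cycle within [G]: only its members are weakened on the way to
   making [G] connected, so that whichever alternative is expelled reaches all of
   [G]. *)
Lemma minimal_ties g : excluded g -> (#|ties g| <= t)%N -> False.
Proof.
case=> gF sg dZ ge [a aY gae] le_t.
have [nae aZ] : a != e /\ a \in Z by move: aY; rewrite !inE => /andP.
have cY : (#|Z :\ e| <= n.+2)%N.
  by have := cardsD1 e Z; rewrite eZ cardZ; clear; lia.
have conn h w : skewsym h -> F h = Z :\ e -> w \in Z :\ e -> reaches h (Z :\ e) w.
  move=> sh hF wY B B0 sBY dB.
  have := forward_connected fwd sh _ B0; rewrite hF => /(_ cY sBY dB).
  by move/subsetP/(_ _ wY).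
have ra := conn _ _ sg gF aY.
set G := Z :\ e :\ a.
have inG y : y \in G -> [/\ y != a, y != e, y \in Z & y \in Z :\ e].
  by rewrite !inE => /and3P[-> -> ->].
have [v0 [v0Z v0e v0a]] := third e a.
have v0G : v0 \in G by rewrite !inE v0a v0e.
pose dominating (B : {set A}) :=
  [&& B != set0, B \subset G & [forall x in B, forall y in G :\: B, 0 < g (x, y)]].
have domP B : B != set0 -> B \subset G -> dominates g B (G :\: B) -> dominating B.
  move=> B0 sBG dB; rewrite /dominating B0 sBG /=.
  by apply/forall_inP=> x xB; apply/forall_inP=> y yB; apply: dB.
have domG : dominating G.
  apply: domP => //; first by apply/set0Pn; exists v0.
  by move=> x y _; rewrite setDv inE.
case: (arg_minnP (fun B : {set A} => #|B|) domG) => G1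
  /and3P[G10 sG1 /forall_inP dG1] minG1.
have {}dG1 x y : x \in G1 -> y \in G :\: G1 -> 0 < g (x, y).
  by move=> xG1; move: y; apply/forall_inP; apply: dG1.
(* Raising to ties creates no new strict victory, so sets dominating in [h] already dominate in
   [g]. *)
have unaffected h : raised g (G :\: G1) G1 0 h -> [/\ shape h a,
    forall y, y \in Z :\ e -> h (y, e) = g (y, e),
    forall w, w \in Z :\ e -> reaches h (Z :\ e) w &
    forall B, B != set0 -> B \subset G -> dominates h B (G :\: B) -> G1 \subset B].
  case=> sh same up.
  have eG : (e \in G) = false by rewrite !inE eqxx andbF.
  have eG1 : (e \in G1) = false by apply: contraFF eG => /(subsetP sG1).
  have he y : y \in Z :\ e -> h (y, e) = g (y, e).
    by move=> yY; rewrite same // inE ?eG ?eG1 ?andbF.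
  have pos x y : 0 < h (x, y) -> 0 < g (x, y).
    case: (boolP ((x \in G :\: G1) && (y \in G1))) => [/andP[xU yV]|n1].
      by have [] := up _ _ xU yV; clear; lia.
    case: (boolP ((x \in G1) && (y \in G :\: G1))) => [/andP[xV yU]|n2].
      by move=> _; apply: dG1.
    by rewrite same.
  have rY w : w \in Z :\ e -> reaches h (Z :\ e) w.
    by move=> wY; apply: reaches_mono (conn _ _ sg gF wY) => x y _ _; apply: pos.
  split=> //.
    split=> //; last exact: rY.
    - move=> x y xZ yZ; have yG : (y \in G) = false by rewrite !inE (negPf yZ) !andbF.
      have yG1 : (y \in G1) = false by apply: contraFF yG => /(subsetP sG1).
      have yU : (y \in G :\: G1) = false by rewrite in_setD yG andbF.
      by rewrite same ?dZ // ?yU ?yG1 ?andbF.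
    - by move=> y yY; rewrite he ?ge.
    - by rewrite he.
  move=> B B0 sBG dB.
  have [BG1|BG1] := eqVneq (B :&: G1) set0.
    have [z zB] := set0Pn _ B0; have [x xG1] := set0Pn _ G10.
    have disj u : u \in B -> u \in G1 -> False.
      by move=> uB uG1; have /setP/(_ u) := BG1; rewrite !inE uB uG1.
    have zU : z \in G :\: G1.
      by rewrite in_setD (subsetP sBG) // andbT; apply/negP => /(disj _ zB).
    have xGB : x \in G :\: B.
      rewrite in_setD (subsetP sG1) // andbT; apply/negP => xB; exact: disj xB xG1.
    have := pos _ _ (dB _ _ zB xGB); have := dG1 _ _ xG1 zU.
    by rewrite (sg x z); clear; lia.
  have dBG1 : dominating (B :&: G1).
    apply: domP => //; first by apply: subset_trans (subsetIl _ _) sBG.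
    move=> x y; rewrite in_setI => /andP[xB xG1].
    rewrite in_setD in_setI negb_and => /andP[nBG1 yG].
    case: (boolP (y \in G1)) nBG1 => [yG1|yG1 _].
      rewrite orbF => yB; apply: pos; apply: dB => //.
      by rewrite in_setD yB.
    by apply: dG1 => //; rewrite in_setD yG1.
  by apply/setIidPr/eqP; rewrite eqEcard subsetIr; apply: minG1.
have disG1 : [disjoint G :\: G1 & G1].
  by rewrite -setI_eq0; apply/eqP/setP=> z; rewrite !inE;
    case: (z \in G1); rewrite ?andbF.
have [h [hF hr hup]] : exists h, [/\ F h = Z :\ e, raised g (G :\: G1) G1 0 h &
    forall y x, y \in G :\: G1 -> x \in G1 -> 0 <= h (y, x)].
  apply: (raise_walk (P := fun h => F h = Z :\ e)) => // h x y hr hr' xG1 yU nxy _ _ hF.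
  have [shh' he rY rG] := unaffected _ hr'; have [sh _ _] := hr.
  have xG := subsetP sG1 _ xG1; have [nxa nxe xZ xY] := inG _ xG.
  have [nya nye yZ yY] : [/\ y != a, y != e, y \in Z & y \in Z :\ e].
    by apply: inG; move: yU; rewrite in_setD => /andP[].
  have le_t' : (#|ties (swap h x y)| <= t)%N.
    by apply: leq_trans le_t; apply: ties_le => z zY; rewrite he // ge //=.
  case: (swap_removes sh (shape_top shh') eZ xZ yZ nxy nye hF) => //; last first.
    by case=> xe; rewrite xe eqxx in nxe.
  (* If [x] is expelled, the lemma to use depends on whether it is tied with [e]. *)
  case=> _ h'F; exfalso; have [xe0|xe0] := eqVneq (g (x, e)) 0.
    apply: (no_tied_removal _ xY h'F le_t').
    by case: shh' => *; split=> //; [rewrite he|exact: rY].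
  apply: (no_untied_removal shh' aY xG _ h'F _ le_t').
    by move=> B B0 sBG dB; apply: (subsetP (rG _ B0 sBG dB)).
  by rewrite he //; have := ge _ xY; move: xe0; clear; lia.
have [shh he rY rG] := unaffected _ hr.
have {}rG w : w \in G -> reaches h G w.
  move=> wG B B0 sBG dB; have sG1B := rG _ B0 sBG dB.
  apply: contraT => wB; have [x xG1] := set0Pn _ G10.
  have wU : w \in G :\: G1.
    by rewrite in_setD wG andbT; apply: contra wB; apply: (subsetP sG1B).
  have wGB : w \in G :\: B by rewrite in_setD wB.
  have := dB x w (subsetP sG1B _ xG1) wGB; have := hup _ _ wU xG1.
  by have [sh _ _] := hr; rewrite (sh x w); clear; lia.
have le_th : (#|ties h| <= t)%N.
  by apply: leq_trans le_t; apply: ties_le => z zY; rewrite he // ge //=.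
move: h hF shh rY rG le_th {hr hup he dZ ge gae ra unaffected sg dG1 minG1 G10
  sG1 disG1 gF domG domP le_t g dominating} => g gF shg rY rG le_t; have [sg dZ ge gae ra] := shg.
(* A second tie with [e] can be broken: expelling [y] is impossible, and keeping the outcome
   contradicts [minimal]. *)
case: (pickP (fun y => (y \in G) && (g (y, e) == 0))) => [y /andP[yG /eqP gye]|noties].
  have [nya nye yZ yY] := inG _ yG.
  have disy : [disjoint [set y] & [set e]] by rewrite disjoints1 inE.
  have keep h : raised g [set y] [set e] 1 h -> shape h a.
    case=> sh same up; split=> //.
    - move=> x z xZ zZ; rewrite same ?dZ // !inE.
        by case: (eqVneq z e) zZ => [->|]; rewrite ?eZ ?andbF.
      by case: (eqVneq z y) zZ => [->|]; rewrite ?yZ ?andbF.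
    - move=> z zY; case: (eqVneq z y) => [->|nzy].
        by have [] := up y e (set11 _) (set11 _); rewrite gye; clear; lia.
      by rewrite same ?ge // !inE ?(negPf nzy) // [e == y]eq_sym (negPf nye) andbF.
    - by rewrite same // !inE ?(negPf nae) // eqxx andbT eq_sym.
    - apply: reaches_mono ra => x z; rewrite !inE => /andP[nxe _] /andP[nze _].
      by rewrite same // !inE ?(negPf nxe) ?(negPf nze) ?andbF.
  have le_raised h z : raised g [set y] [set e] 1 h -> z \in Z :\ e ->
      0 <= g (z, e) <= h (z, e).
    case=> sh same up zY; rewrite ge //=; case: (eqVneq z y) => [->|nzy].
      by have [] := up y e (set11 _) (set11 _).
    by rewrite same // !inE ?(negPf nzy) // [e == y]eq_sym (negPf nye) andbF.
  have [h [hF hr hup]] : exists h, [/\ F h = Z :\ e, raised g [set y] [set e] 1 h &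
      forall x z, x \in [set y] -> z \in [set e] -> 1 <= h (x, z)].
    apply: (raise_walk (P := fun h => F h = Z :\ e)) => // h x z hr hr'.
    rewrite !inE => /eqP xe /eqP zy nxy _ lty hF; subst x z.
    have shh' := keep _ hr'; have [sh same up] := hr.
    case: (swap_removes sh (shape_top shh') eZ eZ yZ nxy nye hF) => //.
      by rewrite eqxx; case.
    case=> _ h'F; exfalso; apply: (no_untied_removal shh' aY yG _ h'F).
    - apply: reaches_mono (rG _ yG) => x z.
      move=> /inG[_ nxe _ _] /inG[_ nze _ _]; have [_ same' _] := hr'.
      by rewrite same' // !inE ?(negPf nxe) ?(negPf nze) ?andbF.
    - by move: lty; rewrite gye.
    - by apply: leq_trans le_t; apply: ties_le => z; apply: le_raised.
  have [sh dZh geh hae _] := keep _ hr.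
  have : (t <= #|ties h|)%N by apply: minimal; split=> //; exists a.
  apply/negP; rewrite -ltnNge; apply: leq_trans le_t; apply: (ties_lt (y := y)) => //.
    by move=> z; apply: le_raised.
  by have := hup y e (set11 _) (set11 _); clear; lia.
(* With [a] as the only tie, [a] can be raised above all of [G], which disconnects the outcome
   [Z :\ e]. *)
have disa : [disjoint [set a] & G] by rewrite disjoints1 !inE eqxx.
have aNG : (a \in G) = false by rewrite !inE eqxx.
have keep h : raised g [set a] G 1 h -> [/\ shape h a,
    forall y, y \in Z :\ e -> h (y, e) = g (y, e) &
    forall w, w \in G -> reaches h G w].
  case=> sh same up.
  have he y : y \in Z :\ e -> h (y, e) = g (y, e).
    by move=> yY; rewrite same // !inE [e == a]eq_sym ?eqxx ?(negPf nae) ?andbF.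
  split=> //.
    split=> //.
    - move=> x z xZ zZ; rewrite same ?dZ // !inE ?(negPf zZ) ?andbF //.
      by case: (eqVneq z a) zZ => [->|]; rewrite ?aZ ?andbF.
    - by move=> y yY; rewrite he ?ge.
    - by rewrite he.
    - move=> B B0 sBY dB; apply: contraT => aB.
      suff: a \in B by rewrite (negPf aB).
      apply: ra => // x y xB yYB; have := dB _ _ xB yYB.
      have nxa : x != a by apply: contraNneq aB => <-.
      case: (boolP ((x \in G) && (y \in [set a]))) => [/andP[xG]|n2]; last first.
        by rewrite same // inE (negPf nxa).
      rewrite inE => /eqP ->; rewrite (sh x a) (sg x a).
      by have [] := up a x (set11 _) xG; clear; lia.
  move=> w wG; apply: reaches_mono (rG _ wG) => x y xG yG.
  have [nxa _ _ _] := inG _ xG; have [nya _ _ _] := inG _ yG.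
  by rewrite same // !in_set1 ?(negPf nxa) ?(negPf nya) ?andbF.
have [h [hF [sh _ _] ha]] : exists h, [/\ F h = Z :\ e, raised g [set a] G 1 h &
    forall z x, z \in [set a] -> x \in G -> 1 <= h (z, x)].
  apply: (raise_walk (P := fun h => F h = Z :\ e)) => // h x z hr hr' xG.
  rewrite inE => /eqP za nxa _ _ hF; subst z.
  have [shh' he rG'] := keep _ hr'; have [sh _ _] := hr.
  have [_ nxe xZ xY] := inG _ xG.
  case: (swap_removes sh (shape_top shh') eZ xZ aZ nxa nae hF) => //; last first.
    by case=> xe; rewrite xe eqxx in nxe.
  case=> _ h'F; exfalso; apply: (no_untied_removal shh' aY xG (rG' _ xG) h'F).
    by rewrite he //; have := ge _ xY; have := noties x; rewrite xG /=; clear; lia.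
  by apply: leq_trans le_t; apply: ties_le => y yY; rewrite he // ge //=.
have : F h \subset [set a].
  apply: (forward_connected fwd sh); rewrite ?hF ?sub1set //.
  by apply/set0Pn; exists a; rewrite inE.
by rewrite hF => /subsetP/(_ v0); rewrite !inE v0e v0Z (negPf v0a) => /(_ isT).
Qed.

End Exclusion.

(** Strong induction on the number of ties supplies [minimal]. *)
Lemma no_excluded n Z e g : forward n.+2 -> backward n.+1 -> #|Z| = n.+3 ->
  e \in Z -> ~ excluded Z e g.
Proof.
move=> fwd bwd cZ eZ; have [t] := ubnP #|ties Z e g|.
elim: t g => // t IHt g; rewrite ltnS => le_t gx.
apply: (minimal_ties fwd bwd cZ eZ (t := t)) gx le_t => g' gx'.
by rewrite leqNgt; apply/negP => lt; apply: (IHt g').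
Qed.

(** * The backward half of the induction and its conclusion *)

Lemma backward_step n : forward n.+1 -> backward n -> backward n.+1.
Proof.
move=> fwd bwd h sh; rewrite leq_eqVlt => /orP[/eqP cY|]; last exact: bwd.
set Y := F h in cY *; have Y0 : Y != set0 by rewrite -card_gt0 cY.
case: (boolP [forall x in Y, forall o in ~: Y, 0 < h (x, o)]) => [dY|].
  have dom : dominant h Y.
    move=> x y xY yY; have /forall_inP := forall_inP dY x xY; apply.
    by rewrite inE.
  rewrite /Y fwd //; apply: leq_trans (subset_leq_card _) (eq_leq cY).
  exact: top_cycle_sub.
rewrite negb_forall_in => /exists_inP[x0 x0Y].
rewrite negb_forall_in => /exists_inP[o]; rewrite inE => oY le0; exfalso.
case: (@arg_minP _ _ _ x0 (mem Y) (fun x => h (x, o)) x0Y) => a aY' amin.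
have {aY'} aY : a \in Y := aY'.
(* As [a] does worst against [o], this lowers [o] exactly until it ties with [a] and beats no member
   of [Y]; the others fall below all of [Y]. *)
pose kappa z := if z == o then `|h (a, o)|%N else bound h.
have hao : (`|h (a, o)|%N)%:Z = - h (a, o).
  by have := amin x0 x0Y; move: le0; clear; lia.
(* Margins outside [Y] are free; letting [o] beat the others makes [o |: Y] dominant. *)
pose h1 : mat := [ffun p => if (p.1 \notin Y) && (p.2 \notin Y)
  then ((p.1 == o) && (p.2 != o))%:Z - ((p.1 != o) && (p.2 == o))%:Z
  else push h Y kappa p].
have sh1 : skewsym h1.
  move=> x y; rewrite [h1 (x, y)]ffunE [h1 (y, x)]ffunE /= [(y \notin Y) && _]andbC.
  case: ifP => _; last exact: skewsym_push.
  rewrite [(y == o) && _]andbC [(y != o) && _]andbC; clear; lia.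
have h1E x y : x \in Y -> h1 (x, y) = push h Y kappa (x, y).
  by move=> xY; rewrite ffunE /= xY.
have h1Y : F h1 = Y.
  apply: (F_free (kappa := kappa) sh sh1) => // [x y xY yY|x y xY yY].
    by rewrite h1E // push_in.
  by rewrite h1E // push_out.
pose Z := o |: Y; have YZ : Z :\ o = Y by rewrite setU1K.
have oZ : o \in Z by rewrite !inE eqxx.
have cZ : #|Z| = n.+2 by rewrite cardsU1 oY cY.
have dZ : dominant h1 Z.
  move=> x y xZ; rewrite !inE negb_or => /andP[nyo yY].
  move: xZ; rewrite !inE => /orP[/eqP ->|xY].
    by rewrite ffunE /= oY yY /= eqxx nyo (negPf nyo).
  rewrite h1E // push_out // /kappa (negPf nyo).
  by have := bound_lt h (x, y); clear; lia.
have ge1 y : y \in Z :\ o -> 0 <= h1 (y, o).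
  rewrite YZ => yY; rewrite h1E // push_out // /kappa eqxx hao.
  by have := amin y yY; clear; lia.
have h1ao : h1 (a, o) = 0 by rewrite h1E // push_out // /kappa eqxx hao subrr.
case: n fwd bwd cY cZ => [|n] fwd bwd cY cZ; last first.
  by apply: (no_excluded fwd bwd cZ oZ (g := h1)); split=> //;
    [rewrite YZ|exists a; rewrite ?YZ].
have Ya : Y = [set a].
  by apply/esym/eqP; rewrite eqEcard sub1set aY cY cards1.
have Z0 : Z != set0 by apply/set0Pn; exists o.
have [h2 sh2 h2Z] := F_surjective Z0.
(* The extra [bound h1] lets [h3] be reached from [h1] by lowering alternatives outside [Z]. *)
pose h3 := push h2 Z (fun=> bound h2 + bound h1)%N.
have sh3 : skewsym h3 by apply: skewsym_push.
have h3Z : F h3 = Z by apply: F_push.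
have aZ : a \in Z by rewrite !inE aY orbT.
have nao : a != o by apply: contraNneq oY => <-.
have big x z : x \in Z -> z \notin Z -> (bound h1)%:Z < h3 (x, z).
  move=> xZ zZ; rewrite push_out //.
  by have := bound_lt h2 (x, z); clear; lia.
(* A strict winner in the pair [Z] would form a singleton top cycle, hence be the outcome by
   [forward]. *)
have nodom x z : x \in Z -> z \in Z -> x != z ->
    (forall w, w \in Z -> w != x -> w = z) -> h3 (x, z) <= 0.
  move=> xZ zZ nxz only; rewrite leNgt; apply/negP => pos.
  have sub : top_cycle h3 \subset [set x].
    apply: top_cycle_sub => //; first by apply/set0Pn; exists x; rewrite inE.
    move=> u v; rewrite !inE => /eqP -> nvx.
    case: (boolP (v \in Z)) => [vZ|vZ]; first by rewrite (only v).
    by have := big _ _ xZ vZ; clear; lia.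
  have := fwd _ sh3; rewrite -(cards1 x) subset_leq_card // => /(_ isT) tF.
  have : z \in [set x] by apply: (subsetP sub); rewrite -tF h3Z.
  by rewrite inE eq_sym (negPf nxz).
have h3ao : h3 (a, o) = 0.
  have Zao w : w \in Z -> w = a \/ w = o.
    by rewrite /Z Ya !inE => /orP[] /eqP ->; [right|left].
  have le1 : h3 (a, o) <= 0.
    by apply: nodom => // w /Zao[] -> //; rewrite eqxx.
  have : h3 (o, a) <= 0.
    by apply: nodom; rewrite // 1?eq_sym // => w /Zao[] -> //; rewrite eqxx.
  by rewrite (sh3 o a); move: le1; clear; lia.
have : F h3 = Y.
  apply: (F_free (kappa := fun z => `|h3 (a, z) - h1 (a, z)|%N) sh1 sh3) => //.
    move=> x y; rewrite Ya !inE => /eqP -> /eqP ->.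
    by rewrite !skewsym_diag.
  move=> x z; rewrite Ya !inE => /eqP -> nza.
  have [->|nzo] := eqVneq z o; first by rewrite h3ao h1ao.
  have zZ : z \notin Z by rewrite /Z Ya !inE negb_or nzo.
  by have := big _ _ aZ zZ; have := bound_lt h1 (a, z); clear; lia.
by rewrite h3Z => ZY; rewrite -ZY oZ in oY.
Qed.

Theorem F_top_cycle h : skewsym h -> F h = top_cycle h.
Proof.
move=> sh; suff main n : forward n /\ backward n.
  exact: (main #|A|).1 _ sh (max_card _).
elim: n => [|n [fwd bwd]].
  split=> g sg.
  - have [x0 _] := set0Pn _ (F_nonempty g).
    by rewrite leqn0 cards_eq0 (negPf (top_cycle_n0 x0 sg)).
  - by rewrite leqn0 cards_eq0 => /eqP F0; have := F_nonempty g; rewrite F0 eqxx.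
by have fwd' := forward_step fwd bwd; split=> //; apply: backward_step.
Qed.

End Rule.

(** * Profiles and their margins *)

Local Open Scope fset_scope.
Local Open Scope fmap_scope.
Local Open Scope ring_scope.

Section Profiles.

Variable A : finType.

Local Notation mat := {ffun A * A -> int}.

Implicit Types (h g : mat) (X Y : {set A}) (r : A -> nat) (R : profile A).
Implicit Types (o : lorder A) (s : seq (lorder A)) (k : nat).

Lemma above_lorder r : is_lorder [ffun p => above r p.1 p.2].
Proof.
apply/and3P; split; apply/forallP=> x.
- by rewrite ffunE /above /=; lia.
- apply/forallP=> y; apply/forallP=> z; rewrite !ffunE /above /=.
  by apply/implyP=> xy; apply/implyP; move: xy; lia.
- apply/forallP=> y; apply/implyP; rewrite !ffunE /above /=.
  by rewrite -(inj_eq (@enum_rank_inj A)) -val_eqE /=; lia.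
Qed.

Definition order_of r : lorder A := Sub _ (above_lorder r).

Lemma lpref_order_of r x y : lpref (order_of r) x y = above r x y.
Proof. by rewrite /lpref SubK ffunE. Qed.

Lemma lprefxx o x : lpref o x x = false.
Proof. by apply/negbTE; have /and3P[/forallP/(_ x)] := valP o. Qed.

Lemma lpref_total o x y : lpref o x y = (x != y) && ~~ lpref o y x.
Proof.
have [<-|nxy] := eqVneq x y; first by rewrite lprefxx.
have /and3P[/forallP irr /forallP tr /forallP tot] := valP o.
have /forallP/(_ y) := tot x; rewrite nxy /= /lpref.
have /forallP/(_ y)/forallP/(_ x) := tr x.
case: (val o (x, y)); case: (val o (y, x)) => //=.
by rewrite (negPf (irr x)).
Qed.

Lemma above_total r x y :
  (above r x y)%:Z + (above r y x)%:Z = (x != y)%:Z.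
Proof.
rewrite -!lpref_order_of [lpref _ x y]lpref_total.
have [->|nxy] := eqVneq x y; first by rewrite lprefxx.
by case: lpref.
Qed.

Lemma rev_lorder o : is_lorder [ffun p => lpref o p.2 p.1].
Proof.
have /and3P[/forallP irr /forallP tr /forallP tot] := valP o.
apply/and3P; split; apply/forallP=> x; first by rewrite ffunE /= lprefxx.
- apply/forallP=> y; apply/forallP=> z; rewrite !ffunE /= /lpref.
  have /forallP/(_ y)/forallP/(_ x) := tr z.
  by case: (val o (z, y)); case: (val o (y, x)).
- apply/forallP=> y; rewrite !ffunE /= [lpref o y x]lpref_total eq_sym.
  by case: (y != x); case: (lpref o x y).
Qed.

Definition rev_order o : lorder A := Sub _ (rev_lorder o).

Lemma lpref_rev o x y : lpref (rev_order o) x y = lpref o y x.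
Proof. by rewrite [LHS]/lpref SubK ffunE. Qed.

Definition votes s : mat :=
  [ffun p => \sum_(o <- s) ((lpref o p.1 p.2)%:Z - (lpref o p.2 p.1)%:Z)].

Lemma votes_nil : votes [::] = 0.
Proof. by apply/ffunP=> p; rewrite !ffunE big_nil. Qed.

Lemma votes_cons o s x y :
  votes (o :: s) (x, y) = (lpref o x y)%:Z - (lpref o y x)%:Z + votes s (x, y).
Proof. by rewrite !ffunE big_cons. Qed.

(* McGarvey's construction: the orders [y > x > rest] and [reversed rest > y > x] cancel
   outside the pair [x, y]. *)
Lemma votes_surjective h : skewsym h -> exists s, votes s = h *+ 2.
Proof.
move=> sh; have s0 : skewsym (0 : mat) by move=> x y; rewrite !ffunE.
apply: (walk (P := fun g => exists s, votes s = g *+ 2) s0 sh); last first.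
  by exists [::]; rewrite votes_nil mul0rn.
move=> g x y _ _ _ nxy _ [s gs].
pose r z := (if z == y then 0 else if z == x then 1 else 2)%N.
pose r' z := (if z == x then 0 else if z == y then 1 else 2)%N.
exists [:: order_of r, rev_order (order_of r') & s]; apply/ffunP=> -[u v].
rewrite !votes_cons gs !lpref_rev !lpref_order_of !ffunMnE swapE.
have nyx : (y == x) = false by rewrite eq_sym (negPf nxy).
have rk : ((enum_rank u == enum_rank v :> nat) = (u == v))%N.
  by rewrite val_eqE (inj_eq (@enum_rank_inj A)).
rewrite /above /r /r'; move: rk.
have [->|nux] := eqVneq u x; have [->|nvx] := eqVneq v x;
  rewrite ?eqxx ?nyx ?(negPf nxy) /=; clear gs sh;
  try (have [->|nuy] := eqVneq u y); try (have [->|nvy] := eqVneq v y);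
  rewrite ?eqxx ?nyx ?(negPf nxy) /=; clear; lia.
Qed.

Lemma marginE R x y : margin R x y =
  \sum_(i <- electorate R) ((vpref R i x y)%:Z - (vpref R i y x)%:Z).
Proof.
have cnt (P : pred nat) : #|` [fset i in electorate R | P i]|%:Z =
    \sum_(i <- electorate R) (P i)%:Z.
  rewrite card_fset_sum1 -big_fset_condE big_mkcond /= -natz natr_sum.
  by apply: eq_bigr => i _; case: (P i).
by rewrite /margin !cnt -sumrB.
Qed.

Definition margins R : mat := [ffun p => margin R p.1 p.2].

Lemma skewsym_margins R : skewsym (margins R).
Proof. by move=> x y; rewrite !ffunE /margin /= opprB. Qed.

Lemma TC_margins R : TC R = top_cycle (margins R).
Proof.
apply/setP=> x; rewrite !inE; apply: eq_forallb => y.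
by apply: eq_connect => u v; rewrite ffunE.
Qed.

(** Voters are numbered from 1, as 0 is no voter, whence the predecessor; the head [o] keeps the
    electorate non-empty. *)
Definition profile_map o s : {fmap nat -> lorder A} :=
  [fmap i : seq_fset tt (iota 1 (size s).+1) => nth o (o :: s) (val i).-1].

Lemma domf_profile_map o s i :
  (i \in domf (profile_map o s)) = (0 < i <= (size s).+1)%N.
Proof. by rewrite seq_fsetE mem_iota. Qed.

Lemma profile_mapP o s : is_profile (profile_map o s).
Proof.
rewrite /is_profile domf_profile_map andbT.
by apply/fset0Pn; exists 1%N; rewrite domf_profile_map.
Qed.

(* The list of orders [o :: s] as a profile, voter [i.+1] having the order of
   index [i]. *)
Definition profile_of o s : profile A := Sub _ (profile_mapP o s).

Lemma electorate_profile_of o s i :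
  (i \in electorate (profile_of o s)) = (0 < i <= (size s).+1)%N.
Proof. exact: domf_profile_map. Qed.

Lemma fnd_profile_of o s i : (i < (size s).+1)%N ->
  (val (profile_of o s)).[? i.+1] = Some (nth o (o :: s) i).
Proof.
move=> lt_i; rewrite SubK; have iE : i.+1 \in domf (profile_map o s).
  by rewrite domf_profile_map.
by rewrite in_fnd ffunE.
Qed.

Lemma margins_profile_of o s : margins (profile_of o s) = votes (o :: s).
Proof.
apply/ffunP=> -[x y]; rewrite !ffunE marginE /=.
have pE : perm_eq (electorate (profile_of o s))
    (map (addn 1) (iota 0 (size s).+1)).
  rewrite -iotaDl addn0; apply: uniq_perm; rewrite ?fset_uniq ?iota_uniq // => i.
  by rewrite electorate_profile_of mem_iota.
rewrite (perm_big _ pE) big_map.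
rewrite -[in RHS](mkseq_nth o (o :: s)) /mkseq big_map [size _]/=.
rewrite big_seq [RHS]big_seq; apply: eq_bigr => i.
rewrite mem_iota add0n => /andP[_ lt_i].
by rewrite add1n /vpref fnd_profile_of.
Qed.

Lemma margins_copies k R R' : is_copies k R R' -> margins R' = margins R *+ k.
Proof.
case=> phi [bij_phi phiE]; apply/ffunP=> -[x y].
rewrite ffunMnE !ffunE !marginE /= !big_seq_fsetE /=.
pose G (p : electorate R * 'I_k) :=
  (vpref R (val p.1) x y)%:Z - (vpref R (val p.1) y x)%:Z.
rewrite (eq_bigr (fun j => G (phi j))); last by move=> j _; rewrite /G !phiE.
have <- : \sum_p G p = \sum_j G (phi j) by apply: reindex; apply: onW_bij.
rewrite -(pair_bigA _ (fun i (j : 'I_k) => G (i, j))) /= -sumrMnl.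
by apply: eq_bigr => i _; rewrite /G /= sumr_const card_ord.
Qed.

(** Copy [j] of voter [i] gets the number [i * k + j], decoded by Euclidean division and positive
    because [i] is. *)
Lemma copies_exist k R : (0 < k)%N -> exists R', is_copies k R R'.
Proof.
move=> k_gt0; pose T := (electorate R * 'I_k)%type.
pose code (p : T) : nat := (val p.1 * k + val p.2)%N.
pose D : {fset nat} := [fset code p | p : T].
have div_code p : (code p %/ k)%N = val p.1.
  by rewrite /code divnMDl // divn_small ?addn0 //; apply: ltn_ord.
have mod_code p : (code p %% k)%N = val p.2.
  by rewrite /code modnMDl modn_small //; apply: ltn_ord.
have DP j : j \in D -> (j %/ k)%N \in electorate R.
  by case/imfsetP=> p _ ->; rewrite div_code; apply: valP.
pose m := [fmap j : D => ((val R).[DP (val j) (valP j)])%fmap].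
have mP : is_profile m.
  have /andP[/fset0Pn[i iR] R0] := valP R; rewrite /is_profile /=; apply/andP; split.
    apply/fset0Pn; exists (code ([` iR], Ordinal k_gt0)); exact: in_imfset.
  apply: contra R0 => /imfsetP[p _ p0].
  have <- : val p.1 = 0%N by rewrite -div_code -p0 div0n.
  exact: valP.
exists (Sub m mP).
pose phi (j : electorate (Sub m mP : profile A)) : T :=
  ([` DP (val j) (valP j)], Ordinal (ltn_pmod (val j) k_gt0)).
have codeD p : code p \in D by apply: in_imfset.
exists phi; split.
  exists (fun p => [` codeD p]) => [j|p].
    apply/val_inj; rewrite /= /code /=; by rewrite -divn_eq.
  rewrite /phi; case: p (codeD p) => i r cD /=.
  by congr pair; apply/val_inj; rewrite /= ?div_code ?mod_code.
move=> j x y; rewrite /vpref in_fnd; first exact: valP.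
move=> jD; rewrite in_fnd; first exact: valP.
move=> jR; congr (lpref _ x y); rewrite ffunE.
by congr fun_of_fin; apply/val_inj.
Qed.

Lemma votes_cons_rev o s : votes (o :: rev_order o :: s) = votes s.
Proof.
apply/ffunP=> -[x y]; rewrite !votes_cons !lpref_rev addrA.
by rewrite -[X in X + _ + _]opprB addNr add0r.
Qed.

Definition any_order : lorder A := order_of (fun=> 0%N).

(* Makes [representation] total: on skew-symmetric matrices this is [h *+ 2]. *)
Definition skew_part h : mat := [ffun p => h p - h (p.2, p.1)].

Lemma skewsym_skew_part h : skewsym (skew_part h).
Proof. by move=> x y; rewrite !ffunE /= opprB. Qed.

Lemma skew_part_skewsym h : skewsym h -> skew_part h = h *+ 2.
Proof.
by move=> sh; apply/ffunP=> -[x y]; rewrite ffunMnE ffunE /= (sh y x) opprK.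
Qed.

Lemma representation_exists h :
  exists s, votes (any_order :: rev_order any_order :: s) == skew_part h *+ 2.
Proof.
have [s <-] := votes_surjective (skewsym_skew_part h).
by exists s; rewrite votes_cons_rev.
Qed.

Definition representation h : profile A :=
  profile_of any_order (rev_order any_order :: xchoose (representation_exists h)).

(** One factor 2 comes from [skew_part], the other from [votes_surjective]. *)
Lemma margins_representation h :
  skewsym h -> margins (representation h) = h *+ 4.
Proof.
move=> sh; rewrite margins_profile_of (eqP (xchooseP (representation_exists h))).
by rewrite skew_part_skewsym // -mulrnA.
Qed.

(** * From choice correspondences to functions of the matrix *)

Section Rules.

Variable f : SCC A.

Hypothesis f_pairwise : pairwise_scc f.

Lemma pairwise_margins R R' : margins R = margins R' -> f R = f R'.
Proof.
move=> eqRR'; apply: f_pairwise => x y.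
by have := congr1 (fun h : mat => h (x, y)) eqRR'; rewrite !ffunE.
Qed.

Hypothesis f_homogeneous : homogeneous f.

Lemma homogeneous_margins k R R' :
  (0 < k)%N -> margins R' = margins R *+ k -> f R' = f R.
Proof.
move=> k_gt0 eqR'; have [R1 copR1] := copies_exist R k_gt0.
rewrite -(f_homogeneous k_gt0 copR1); apply: pairwise_margins.
by rewrite eqR' (margins_copies copR1).
Qed.

(** Homogeneity absorbs the factor 4 of [representation]. *)
Definition outcome h : {set A} := f (representation h).

Lemma outcome_margins R : outcome (margins R) = f R.
Proof.
apply: (homogeneous_margins (k := 4)) => //.
by apply: margins_representation; apply: skewsym_margins.
Qed.

Lemma outcome_homogeneous h k :
  skewsym h -> (0 < k)%N -> outcome (h *+ k) = outcome h.
Proof.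
move=> sh k_gt0; apply: (homogeneous_margins k_gt0).
rewrite !margins_representation // -?mulrnA 1?mulnC //.
by move=> x y; rewrite !ffunMnE (sh x y) mulNrn.
Qed.

(** Voter 1 has order [r], voter 2 its reverse, and the rest realise [h *+ 2]. Replacing [r] by [r']
    changes margins by twice the amounts in the hypothesis, giving [h' *+ 2]. *)
Lemma outcome_strategyproof r r' h h' : strategyproof f -> skewsym h ->
    (forall x y, h' (x, y) = h (x, y) + (above r' x y)%:Z - (above r x y)%:Z) ->
    outcome h' != outcome h ->
    (forall u v, u \in outcome h' :\: outcome h -> v \in outcome h ->
       above r u v) ->
    (forall u v, u \in outcome h' -> v \in outcome h :\: outcome h' ->
       above r u v) ->
  False.
Proof.
move=> f_sp sh diff neq up down; have [s sE] := votes_surjective sh.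
have sh' : skewsym h'.
  move=> x y; rewrite !diff (sh x y).
  by have := above_total r x y; have := above_total r' x y; clear; lia.
pose o := order_of r; pose o' := order_of r'.
pose P := profile_of o (rev_order o :: s).
pose P' := profile_of o' (rev_order o :: s).
have PE : margins P = h *+ 2 by rewrite margins_profile_of votes_cons_rev.
have P'E : margins P' = h' *+ 2.
  rewrite margins_profile_of; apply/ffunP=> -[x y].
  rewrite !votes_cons !lpref_rev !lpref_order_of sE !ffunMnE diff !mulr2n.
  move: (h (x, y)) (above_total r x y) (above_total r' x y) => v; clear; lia.
have fP : f P = outcome h.
  by rewrite -outcome_margins PE outcome_homogeneous.
have fP' : f P' = outcome h'.
  by rewrite -outcome_margins P'E outcome_homogeneous.
have elec : electorate P = electorate P'.
  by apply/fsetP=> i; rewrite !electorate_profile_of.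
have others j : j \in electorate P -> j != 1%N -> (val P).[? j] = (val P').[? j].
  rewrite electorate_profile_of; case: j => [|[|j]] // lt_j _.
  rewrite !fnd_profile_of //; congr Some; exact: set_nth_default.
have voter1 : 1%N \in electorate P by rewrite electorate_profile_of.
case/negP: (f_sp _ _ _ elec voter1 others o (fnd_profile_of _ (ltn0Sn _))).
rewrite fP fP'; apply/and3P; split=> //.
  apply/forall_inP=> u uD; apply/forall_inP=> v vD.
  by rewrite lpref_order_of up.
apply/forall_inP=> u uD; apply/forall_inP=> v vD.
by rewrite lpref_order_of down.
Qed.

End Rules.

Lemma strategyproof_top_cycle (f : SCC A) :
    is_scc f -> pairwise_scc f -> strategyproof f -> set_non_imposition f ->
    homogeneous f ->
  forall R, f R = TC R.
Proof.
move=> f_n0 f_pw f_sp f_sni f_hom R; rewrite TC_margins -outcome_margins //.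
apply: (@F_top_cycle A (outcome f)); last exact: skewsym_margins.
- by move=> h k; apply: outcome_homogeneous.
- by move=> r r' h h'; apply: outcome_strategyproof.
- by move=> h; apply: f_n0.
move=> X /f_sni[R' fR']; exists (margins R'); first exact: skewsym_margins.
by rewrite outcome_margins.
Qed.

(** * The top cycle has the three properties *)

Lemma top_cycle_homogeneous h k : (0 < k)%N -> top_cycle (h *+ k) = top_cycle h.
Proof.
move=> k_gt0; apply/setP=> x; rewrite !inE; apply: eq_forallb => y.
by apply: eq_connect => u v; rewrite ffunMnE pmulrn_lge0.
Qed.

Lemma TC_homogeneous : homogeneous (@TC A).
Proof.
move=> k R R' k_gt0 /margins_copies copR'.
by rewrite !TC_margins copR' top_cycle_homogeneous.
Qed.

Lemma top_cycle_block X : X != set0 -> top_cycle (block X) = X.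
Proof.
move=> X0; apply: (top_cycleP (skewsym_block X) X0) => [x y xX yX|B B0 sBX dB].
  by rewrite ffunE /= xX yX.
apply/subsetP=> y yX; apply: contraT => yB; have [x xB] := set0Pn _ B0.
by have := dB _ _ xB yB; rewrite ffunE /= (subsetP sBX _ xB) yX.
Qed.

Lemma TC_set_non_imposition : set_non_imposition (@TC A).
Proof.
move=> X X0; exists (representation (block X)); rewrite TC_margins.
rewrite margins_representation; last exact: skewsym_block.
by rewrite top_cycle_homogeneous // top_cycle_block.
Qed.

(** Here [p] is the true preference, along which a misreport can only lower margins. If the old top
    cycle is inside the new one, it stays dominant; otherwise the new one, or its common part with
    the old, contradicts the old one. *)
Lemma top_cycle_strategyproof h h' (p : rel A) : skewsym h -> skewsym h' ->
    (forall x y, p x y -> h' (x, y) <= h (x, y)) ->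
    top_cycle h' != top_cycle h ->
    (forall x y, x \in top_cycle h' :\: top_cycle h -> y \in top_cycle h -> p x y) ->
    (forall x y, x \in top_cycle h' -> y \in top_cycle h :\: top_cycle h' -> p x y) ->
  False.
Proof.
move=> sh sh' le neq up down.
have dX := top_cycle_dominant sh; have dY := top_cycle_dominant sh'.
have [sXY|] := boolP (top_cycle h \subset top_cycle h').
  case/negP: neq; rewrite eqEsubset sXY andbT.
  have [->|Y0] := eqVneq (top_cycle h') set0; first exact: sub0set.
  have [x0 _] := set0Pn _ Y0; apply: top_cycle_sub => //.
    exact: (top_cycle_n0 x0 sh).
  move=> x y xX yX; have [yY|yY] := boolP (y \in top_cycle h').
    have := le y x (up y x _ xX); rewrite inE yX yY => /(_ isT).
    by have := dX _ _ xX yX; rewrite (sh x y) (sh' x y); clear; lia.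
  by apply: dY => //; apply: (subsetP sXY).
case/subsetPn=> x0 x0X x0Y.
have x0D : x0 \in top_cycle h :\: top_cycle h' by rewrite inE x0Y.
have [XY0|XYn0] := eqVneq (top_cycle h :&: top_cycle h') set0.
  have [y0 y0Y] := set0Pn _ (top_cycle_n0 x0 sh').
  have y0X : y0 \notin top_cycle h.
    by apply/negP => y0X; have /setP/(_ y0) := XY0; rewrite in_setI y0X y0Y inE.
  have := le _ _ (down _ _ y0Y x0D); have := dY _ _ y0Y x0Y.
  by have := dX _ _ x0X y0X; rewrite (sh x0 y0); clear; lia.
have sub : top_cycle h \subset top_cycle h :&: top_cycle h'.
  apply: top_cycle_sub => // x y; rewrite !in_setI => /andP[xX xY].
  rewrite negb_and; have [yX /= yY|yX _] := boolP (y \in top_cycle h).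
    have := le _ _ (down x y xY _); rewrite inE yX yY => /(_ isT).
    by have := dY _ _ xY yY; clear; lia.
  exact: dX.
by have := subsetP sub _ x0X; rewrite in_setI (negPf x0Y) andbF.
Qed.

Lemma TC_strategyproof : strategyproof (@TC A).
Proof.
move=> R R' i elec iR same o Ro; apply/negP => /and3P[]; rewrite !TC_margins.
move=> neq /forall_inP up /forall_inP down.
apply: (@top_cycle_strategyproof (margins R) (margins R') (lpref o)) => //.
- exact: skewsym_margins.
- exact: skewsym_margins.
(* The truthful voter already contributes the maximum 1 to this margin. *)
- move=> x y oxy; rewrite !ffunE !marginE /= -elec big_seq [leRHS]big_seq.
  apply: ler_sum => j jR; have [->|nji] := eqVneq j i; last first.
    by rewrite /vpref same.
  have vR u v : vpref R i u v = lpref o u v by rewrite /vpref Ro.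
  rewrite !vR [lpref o y x]lpref_total oxy andbF.
  by do 2 case: vpref.
- by move=> x y xD; move: y; apply/forall_inP; apply: up.
by move=> x y xD; move: y; apply/forall_inP; apply: down.
Qed.

End Profiles.

Theorem theorem2 (A : finType) (f : SCC A) :
  is_scc f -> pairwise_scc f ->
  ((strategyproof f /\ set_non_imposition f /\ homogeneous f) <->
   (forall R : profile A, f R = TC R)).
Proof.
move=> f_n0 f_pw; split=> [[f_sp [f_sni f_hom]]|fE].
  exact: strategyproof_top_cycle.
split; first by move=> *; rewrite !fE; apply: TC_strategyproof; eassumption.
split; first by move=> X /TC_set_non_imposition[R <-]; exists R.
by move=> k R R' k_gt0 copR'; rewrite !fE; apply: TC_homogeneous copR'.
Qed.
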